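(* Let $K$ be a number field with $[K:\mathbb Q]>1$, ring of integers $\mathscr O$ and different $\mathfrak d$, and let $p$ be a prime number ramified in $K$. The following are equivalent: (i) the $p$-primary component of the additive group of the ring $\mathscr O/\mathfrak d$ is cyclic; (ii) there is exactly one ramified prime ideal $\mathfrak p$ of $\mathscr O$ lying over $p$, and moreover $p$ is odd, $\mathrm{ord}_{\mathfrak p}(p\mathscr O)=2$, and $\mathscr O/\mathfrak p$ is the field with $p$ elements.
   Context: The codifferent $\mathfrak c=\{x\in K:\mathrm{Trace}_{K/\mathbb Q}(x\mathscr O)\subseteq\mathbb Z\}$ and the different is $\mathfrak d=\mathfrak c^{-1}=\{x\in K: x\mathfrak c\subseteq\mathscr O\}$, an ideal of $\mathscr O$. For a nonzero prime ideal $\mathfrak a$ and nonzero ideal $\mathfrak b$ of $\mathscr O$, $\mathrm{ord}_{\mathfrak a}\mathfrak b$ is the largest $t\ge0$ with $\mathfrak a^t\supseteq\mathfrak b$. *)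

(* Defs.v *)
From HB Require Import structures.
From mathcomp Require Import all_boot all_order all_algebra all_field.
From mathcomp Require Import ring_quotient boolp.
Set Implicit Arguments.
Unset Strict Implicit.
Unset Printing Implicit Defensive.
Import Order.TTheory GRing.Theory Num.Theory.
Local Open Scope ring_scope.

Section Ideals.
Variable R : comNzRingType.
Implicit Types I J : {pred R}.

Definition ideal_mul I J : {pred R} := fun x =>
  `[< exists2 s : seq (R * R),
        {in s, forall u, u.1 \in I /\ u.2 \in J} & x = \sum_(u <- s) u.1 * u.2 >].

Definition ideal_exp I (t : nat) : {pred R} := iter t (ideal_mul I) predT.

Definition principal_ideal (a : R) : {pred R} := fun x =>
  `[< exists y, x = a * y >].

(* As a relation: the maximum defining ord exists for nonzero J in a
   Dedekind ring, but not in an arbitrary R. *)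
Definition is_ord I J (t : nat) :=
  {subset J <= ideal_exp I t} /\
  forall s : nat, {subset J <= ideal_exp I s} -> (s <= t)%N.

Definition lies_over I (p : nat) :=
  forall n : int, (n%:~R \in I) = (p %| n)%Z.

Definition ramified_over I (p : nat) :=
  lies_over I p /\
  exists2 e : nat, is_ord I (principal_ideal p%:R) e & (1 < e)%N.

End Ideals.

Section AdditiveGroups.
Variable A : zmodType.

Definition primary_component (p : nat) : {pred A} := fun x =>
  `[< exists k : nat, x *+ (p ^ k)%N = 0 >].

Definition cyclic_subgroup (H : {pred A}) :=
  exists2 g, g \in H & forall x, x \in H -> exists n : int, x = g *~ n.

End AdditiveGroups.
Arguments primary_component : clear implicits.

Section NumberField.
Variable K : fieldExtType rat.

Definition integers : {pred K} := fun x => `[< integralOver (intr : int -> K) x >].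

Fact integers_subring_closed : subring_closed integers.
Proof.
split=> [|x y /asboolP xI /asboolP yI|x y /asboolP xI /asboolP yI]; apply/asboolP.
- exact: integral1.
- exact: integral_sub.
- exact: integral_mul.
Qed.

HB.instance Definition _ :=
  GRing.isSubringClosed.Build K integers integers_subring_closed.

Record ring_of_integers :=
  RingOfIntegers { integer_val : K; _ : integer_val \in integers }.

HB.instance Definition _ := [isSub for integer_val].
HB.instance Definition _ := [Choice of ring_of_integers by <:].
HB.instance Definition _ :=
  [SubChoice_isSubComNzRing of ring_of_integers by <:].

Definition trace (x : K) : rat :=
  \tr (passmx.mxof (vbasis {:K}) (vbasis {:K}) (amull x)).

Definition codifferent : {pred K} := fun x =>
  `[< forall y, y \in integers -> trace (x * y) \is a Num.int >].

Definition different : {pred K} := fun x =>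
  `[< forall y, y \in codifferent -> x * y \in integers >].

(* The different is contained in the ring of integers, so nothing is lost in
   this preimage under the inclusion into K. *)
Definition different_ideal : {pred ring_of_integers} :=
  fun x => \val x \in different.

Fact different_zmod_closed : zmod_closed different_ideal.
Proof.
split=> [|x y /asboolP xD /asboolP yD]; apply/asboolP => z zC.
  by rewrite raddf0 mul0r rpred0.
by rewrite raddfB mulrBl rpredB ?xD ?yD.
Qed.

HB.instance Definition _ :=
  GRing.isZmodClosed.Build ring_of_integers different_ideal different_zmod_closed.

(* The ring structure of the library quotient is only available for proper
   ideals; its additive group is available for any additive subgroup. *)
Definition integers_mod_different : zmodType := Quotient.quot different_ideal.

Definition ramified_in (p : nat) :=
  exists P : prime_idealr ring_of_integers, ramified_over P p.

End NumberField.

(* Main.v *)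
From HB Require Import structures.
Require Import Defs.
From mathcomp Require Import all_boot all_order all_algebra all_field.
From mathcomp Require Import ring_quotient boolp ring.
Set Implicit Arguments.
Unset Strict Implicit.
Unset Printing Implicit Defensive.
Import Order.TTheory GRing.Theory Num.Theory.
Local Open Scope ring_scope.

(** Let [O] be the ring of integers, [c] the codifferent, [A = O/pO], and let
    [Rad] be the radical of the trace form of the [F_p]-algebra [A].
    Multiplication by [p] identifies the [p]-torsion of [c/O] with [Rad], so
    [d Rad = 0] in [A].  The ideal [Ann Rad] then contains [d + pO], and both
    directions reduce to statements about [A] and its primes.

    If the [p]-part of [O/d] is cyclic, then [O/Ann(Rad)] is a cyclic group
    killed by [p].  For a ramified [P] over [p] let [e] be the idempotent of [A]
    cutting out the local factor [A_P].  Elements of [eP] are nilpotent, hence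
    in [Rad], and [eP] is nonzero as [p] is in [P^2]; this forces
    [Ann Rad = P], so that [P] is unique, [O/P = F_p] and [e P^2 = 0].  Thus
    [ord_P p = 2] and [A_P] has dimension 2; if [p = 2] then [e], whose trace is
    2, would lie in [Rad], contradicting [P Rad = 0].

    Conversely, [(1 - e) A] is reduced since [P] is the only ramified prime, so
    its trace form is nondegenerate, while [A_P] has dimension 2 and [p] is odd;
    hence [Rad] is contained in [eP] and [P Rad = 0].  As [p] is in [P^2], this
    gives [P c] contained in [O] locally at [p], i.e. [P] is contained in [d]
    locally at [p], and [O/P = F_p] is cyclic.

    Invertibility of [P] enters only through an element [w] outside [pO] with
    [w P] inside [pO] (so that [w/p] is in [P^-1] but not in [O]). *)

(** * Traces of matrices and nondegenerate trace forms *)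

(** For the rank factorization [A = C R], the matrix [R C] has the same trace, and
    [A^(k+1) = C (R C)^k R] shows that its nilpotency exponent is smaller. *)
Lemma mxtrace_nilpotent (F : fieldType) N n (A : 'M[F]_n) :
  A ^+ N = 0 -> \tr A = 0.
Proof.
elim: N n A => [|N IHN] n A AN0.
  by rewrite -[A]mulr1 -(expr0 A) AN0 mulr0 mxtrace0.
have powS k : A ^+ k.+1 =
    col_base A *m (row_base A *m col_base A) ^+ k *m row_base A.
  elim: k => [|k IHk]; first by rewrite expr1 expr0 mulmx1 mulmx_base.
  rewrite exprS IHk -{1}[A]mulmx_base exprS.
  by rewrite -!mulmxE !mulmxA.
rewrite -[A]mulmx_base mxtrace_mulC; apply: IHN.
apply: (row_full_inj (col_base_full A)).
apply: (row_free_inj (row_base_free A)).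
by rewrite -powS AN0 mulmx0 mul0mx.
Qed.

(** The full-rank factors cancel on both sides of [C R C R = C R]. *)
Lemma mul_row_col_base (F : fieldType) n (A : 'M[F]_n) :
  A *m A = A -> row_base A *m col_base A = 1%:M.
Proof.
move=> AA; apply: (row_full_inj (col_base_full A)).
apply: (row_free_inj (row_base_free A)).
by rewrite mulmx1 mulmx_base mulmxA mulmx_base -mulmxA mulmx_base.
Qed.

Lemma mxtrace_idempotent (F : fieldType) n (A : 'M[F]_n) :
  A *m A = A -> \tr A = (\rank A)%:R.
Proof.
move=> /mul_row_col_base RC; rewrite -[A in LHS]mulmx_base mxtrace_mulC RC.
by rewrite mxtrace1.
Qed.

(** The [S i] are simultaneously diagonalizable over an algebraic closure, since
    ['X^(p ^ c) - 'X] is separable; listing the diagonals in a square matrix [D],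
    which is invertible by independence, the Gram matrix is [D *m D^T]. *)
Lemma trace_form_nondegenerate p r (S : 'I_r -> 'M['F_p]_r) : prime p ->
    (forall i j, S i *m S j = S j *m S i) ->
    (forall i, exists2 c, (0 < c)%N & S i ^+ (p ^ c)%N = S i) ->
    (forall v : 'rV_r, \sum_i v 0 i *: S i = 0 -> v = 0) ->
  forall v : 'rV_r, (forall j, \sum_i v 0 i * \tr (S i *m S j) = 0) -> v = 0.
Proof.
move=> pP Scomm Spow Sfree v trv.
case: r => [|r] in S Scomm Spow Sfree v trv *; first exact: thinmx0.
have [L [f _]] := countable_algebraic_closure 'F_p.
have pL : p \in [pchar L] by rewrite (fmorph_pchar f) pchar_Fp.
pose T i := map_mx f (S i).
have [] : codiagonalizable [seq T i | i <- enum 'I_r.+1].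
  apply/codiagonalizableP; split.
    move=> _ _ /mapP[i _ ->] /mapP[j _ ->].
    by rewrite /comm_mx /T -!map_mxM Scomm.
  move=> _ /mapP[i _ ->]; apply/diagonalizableP.
  have [c c_gt0 Sc] := Spow i.
  (* [P] annihilates [T i], and its roots are distinct because its derivative is [-1]. *)
  pose P : {poly L} := 'X^(p ^ c) - 'X.
  have [rs Prs] := closed_field_poly_normal P.
  have pc_gt1 : (1 < p ^ c)%N by rewrite -(exp1n c) ltn_exp2r ?prime_gt1.
  have sP : size P = (p ^ c).+1.
    by rewrite size_polyDl ?size_polyXn// size_polyN size_polyX.
  have P_monic : P \is monic.
    by rewrite monicE lead_coefDl ?lead_coefXn// size_polyXn size_polyN size_polyX.
  rewrite (monicP P_monic) scale1r in Prs.
  exists rs.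
    rewrite -separable_prod_XsubC -Prs unlock derivB derivXn derivX.
    have -> : 'X^((p ^ c).-1) *+ (p ^ c)%N = 0 :> {poly L}.
      by rewrite -mulr_natr -(prednK c_gt0) expnS natrM pcharf0 ?mul0r ?mulr0// pchar_poly.
    by rewrite sub0r coprimep_sym -scaleN1r coprimepZl ?oppr_eq0 ?oner_eq0 ?coprime1p.
  rewrite -Prs; apply: mxminpoly_min.
  by rewrite rmorphB rmorphXn/= !horner_mx_X /T -rmorphXn/= Sc subrr.
move=> P P_unit /allP/= Pdiag.
have {Pdiag} Td i : {d | T i = invmx P *m diag_mx d *m P}.
  have /Pdiag/diagonalizable_forLR : T i \in [seq T i | i <- enum 'I_r.+1].
    by rewrite map_f ?mem_enum.
  move=> /(_ P_unit)/cid[d ->]; exists d.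
  by rewrite mxpoly.conjumx ?unitmx_inv// invmxK.
pose D : 'M[L]_r.+1 := \matrix_i tag (Td i).
have TD i : T i = invmx P *m diag_mx (row i D) *m P.
  by rewrite rowK; case: (Td i).
have trT i j : \tr (T i *m T j) = (D *m D^T) i j.
  rewrite !TD !mulmxA mulmxK// mxtrace_mulC !mulmxA mulmxV// mul1mx.
  rewrite mulmx_diag mxtrace_diag mxE.
  by apply: eq_bigr => k _; rewrite !mxE.
pose B : 'M['F_p]_(r.+1, r.+1 * r.+1) := \matrix_i mxvec (S i).
have B_free : row_free B.
  rewrite -kermx_eq0; apply/eqP/row_matrixP => i; rewrite row0; apply: Sfree.
  apply: (can_inj mxvecK); rewrite linear_sum linear0/=.
  have /sub_kermxP := row_sub i (kermx B); rewrite mulmx_sum_row => {2}<-.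
  by apply: eq_bigr => k _; rewrite linearZ/= !rowK.
(* A relation [u *m D = 0] makes the combination of the [T k] with coefficients [u] vanish, while
   the independence of the [S k] persists over [L]. *)
have D_unit : D \in unitmx.
  rewrite -row_free_unit -kermx_eq0; apply/eqP/row_matrixP => i; rewrite row0.
  have /sub_kermxP := row_sub i (kermx D); set u := row i _ => uD.
  have : row_free (map_mx f B) by rewrite row_free_map.
  move=> /row_free_inj; apply; rewrite mul0mx mulmx_sum_row.
  have -> : \sum_k u 0 k *: row k (map_mx f B) = mxvec (\sum_k u 0 k *: T k).
    rewrite linear_sum; apply: eq_bigr => k _.
    by rewrite linearZ/= -map_row rowK map_mxvec.
  suff -> : \sum_k u 0 k *: T k = invmx P *m diag_mx (u *m D) *m P.
    by rewrite uD !linear0 mul0mx linear0.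
  rewrite mulmx_sum_row linear_sum mulmx_sumr mulmx_suml.
  by apply: eq_bigr => k _; rewrite TD linearZ/= -scalemxAr -scalemxAl.
apply: (map_mx_inj (f := f)); rewrite map_mx0.
have : row_free (D *m D^T) by rewrite row_free_unit unitmx_mul unitmx_tr D_unit.
move=> /row_free_inj; apply; rewrite mul0mx; apply/rowP => j.
rewrite [LHS]mxE [RHS]mxE -[RHS](rmorph0 f) -[in RHS](trv j) rmorph_sum.
by apply: eq_bigr => i _; rewrite mxE -trT rmorphM/= -trace_map_mx map_mxM.
Qed.

(** * Powers of ideals *)

Section IdealPowers.
Variable R : comNzRingType.
Implicit Types (I J : {pred R}) (P : idealr R).

Lemma mem_ideal_mul I J a b : a \in I -> b \in J -> a * b \in ideal_mul I J.
Proof.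
move=> aI bJ; apply/asboolP; exists [:: (a, b)]; last by rewrite big_seq1.
by move=> u; rewrite inE => /eqP ->.
Qed.

Lemma ideal_mul_ind I J (T : R -> Prop) :
    T 0 -> (forall a b, T a -> T b -> T (a + b)) ->
    (forall a b, a \in I -> b \in J -> T (a * b)) ->
  forall x, x \in ideal_mul I J -> T x.
Proof.
move=> T0 TD TM x /asboolP[s sIJ ->]; rewrite big_seq.
by elim/big_ind: _ => // u /sIJ[uI uJ]; apply: TM.
Qed.

Lemma ideal_mulD I J x y :
  x \in ideal_mul I J -> y \in ideal_mul I J -> x + y \in ideal_mul I J.
Proof.
move=> /asboolP[s sIJ ->] /asboolP[t tIJ ->]; apply/asboolP; exists (s ++ t).
  by move=> u; rewrite mem_cat => /orP[/sIJ|/tIJ].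
by rewrite big_cat.
Qed.

Lemma ideal_expD P s x y :
  x \in ideal_exp P s -> y \in ideal_exp P s -> x + y \in ideal_exp P s.
Proof. by case: s => // s; apply: ideal_mulD. Qed.

Lemma mem_ideal_exp0 P s : 0 \in ideal_exp P s.
Proof.
case: s => // s; apply/asboolP; exists [::]; first by move=> u; rewrite in_nil.
by rewrite big_nil.
Qed.

Lemma ideal_expMl P s a x : x \in ideal_exp P s -> a * x \in ideal_exp P s.
Proof.
case: s => // s; elim/ideal_mul_ind => [|x1 x2 ? ?|x1 x2 x1P x2P].
- by rewrite mulr0 (mem_ideal_exp0 P s.+1).
- by rewrite mulrDr ideal_mulD.
- by rewrite mulrA mem_ideal_mul// idealMr.
Qed.

Lemma ideal_exp_le P s t : (s <= t)%N -> {subset ideal_exp P t <= ideal_exp P s}.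
Proof.
move=> /subnK <-; elim: (t - s)%N => [|k IHk] x //=.
elim/ideal_mul_ind => [|a b aP bP|a b _ /IHk bP]; first exact: mem_ideal_exp0.
  exact: ideal_expD.
exact: ideal_expMl.
Qed.

Lemma ideal_exp1 P : ideal_exp P 1 =i P.
Proof.
move=> x; apply/idP/idP => [|xP]; last by rewrite -[x]mulr1 mem_ideal_mul.
by elim/ideal_mul_ind => [|a b aP bP|a b aP _]; rewrite ?rpred0 ?rpredD// mulrC idealMr.
Qed.

Lemma mem_ideal_exp2 P a b : a \in P -> b \in P -> a * b \in ideal_exp P 2.
Proof. by move=> aP bP; apply: mem_ideal_mul; rewrite // -/(ideal_exp P 1) ideal_exp1. Qed.

(** Turns the two conditions of [is_ord] for [p] into membership of [p] in powers of [P]. *)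
Lemma principal_ideal_sub P s a :
  {subset principal_ideal a <= ideal_exp P s} <-> a \in ideal_exp P s.
Proof.
split=> [|aP x /asboolP[y ->]]; last by rewrite mulrC ideal_expMl.
by apply; apply/asboolP; exists 1; rewrite mulr1.
Qed.

End IdealPowers.

(** * Reduction modulo a prime number *)

(** [phi] is the reduction [R -> R/pR] in coordinates: [phi x = 0] means that
    [p] divides [x], and congruences mod [p] are equalities [phi x = phi y]. *)
Section ReductionModP.
Variables (R : comNzRingType) (p n : nat) (phi : {additive R -> 'rV['F_p]_n}).
Hypothesis p_prime : prime p.
Hypothesis phi_surj : forall v, exists x, phi x = v.
Hypothesis phi_ker : forall x, phi x = 0 <-> exists y, x = p%:R * y.

Let sec v : R := sval (cid (phi_surj v)).

Let secK v : phi (sec v) = v.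
Proof. exact: svalP (cid (phi_surj v)). Qed.

Lemma reduction_p y : phi (p%:R * y) = 0.
Proof. by apply/phi_ker; exists y. Qed.

Lemma reduction_mul0 x y : phi x = 0 -> phi (x * y) = 0.
Proof. by case/phi_ker=> z ->; rewrite -mulrA reduction_p. Qed.

Lemma reduction_mull x y z : phi x = phi y -> phi (x * z) = phi (y * z).
Proof.
move=> xy; apply/eqP; rewrite -subr_eq0 -raddfB -mulrBl; apply/eqP.
by apply: reduction_mul0; rewrite raddfB xy subrr.
Qed.

Lemma reduction_mulr x y z : phi x = phi y -> phi (z * x) = phi (z * y).
Proof. by rewrite ![z * _]mulrC; apply: reduction_mull. Qed.

(** The matrix of multiplication by [y] on [R/pR], acting on row vectors from the right. *)
Definition mulmat (y : R) : 'M['F_p]_n := \matrix_i phi (sec (delta_mx 0 i) * y).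

Lemma scale_reduction (a : 'F_p) x : a *: phi x = phi (x *+ a).
Proof.
rewrite raddfMn -scaler_nat; congr (_ *: _).
by rewrite natr_Zp.
Qed.

Lemma reductionM x y : phi (x * y) = phi x *m mulmat y.
Proof.
rewrite mulmx_sum_row.
under eq_bigr do rewrite rowK scale_reduction -mulrnAl.
rewrite -raddf_sum -mulr_suml; apply: reduction_mull.
rewrite raddf_sum [LHS]row_sum_delta; apply: eq_bigr => i _.
by rewrite -scale_reduction secK.
Qed.

Lemma row_mulmat x y i : phi x = delta_mx 0 i -> row i (mulmat y) = phi (x * y).
Proof. by move=> xi; rewrite reductionM xi -rowE. Qed.

Lemma mulmat_inj x : phi x = 0 <-> mulmat x = 0.
Proof.
split=> [x0|x0]; last by rewrite -[x]mul1r reductionM x0 mulmx0.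
by apply/row_matrixP => i; rewrite rowK row0 mulrC reduction_mul0.
Qed.

Lemma mulmatD : {morph mulmat : x y / x + y}.
Proof. by move=> x y; apply/matrixP => i j; rewrite !mxE mulrDr raddfD mxE. Qed.

Lemma mulmat0 : mulmat 0 = 0.
Proof. by apply/matrixP => i j; rewrite !mxE mulr0 raddf0 mxE. Qed.

Lemma mulmatM : {morph mulmat : x y / x * y >-> x *m y}.
Proof. by move=> x y; apply/row_matrixP => i; rewrite row_mul !rowK mulrA reductionM. Qed.

Lemma mulmat1 : mulmat 1 = 1%:M.
Proof. by apply/row_matrixP => i; rewrite rowK mulr1 secK row1. Qed.

Lemma mulmatN x : mulmat (- x) = - mulmat x.
Proof. by apply/matrixP => i j; rewrite !mxE mulrN raddfN mxE. Qed.

Lemma mulmatX x k : mulmat (x ^+ k) = mulmat x ^+ k.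
Proof. by elim: k => [|k IH]; rewrite ?mulmat1// !exprS mulmatM IH. Qed.

Lemma mulmat_eq x y : phi x = phi y -> mulmat x = mulmat y.
Proof.
move=> xy; apply/eqP; rewrite -subr_eq0 -mulmatN -mulmatD; apply/eqP.
by apply/mulmat_inj; rewrite raddfB xy subrr.
Qed.

(** [R/pR] is finite. *)
Lemma reduction_pigeonhole (g : nat -> R) :
  exists i d, (0 < d)%N /\ phi (g i) = phi (g (i + d)%N).
Proof.
pose T := 'rV['F_p]_n; pose h (k : 'I_#|T|.+1) := phi (g k).
have /injectivePn[i [j ij hij]] : ~~ injectiveb h.
  apply/injectiveP => /leq_card; rewrite card_ord ltnn//.
wlog lt_ij : i j ij hij / (i < j)%N.
  move=> W; case: (ltngtP i j) => [||/val_inj]; [exact: W|..].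
    by apply: W; rewrite // eq_sym.
  by move/eqP; rewrite (negPf ij).
by exists i, (j - i)%N; rewrite subn_gt0 subnKC// ltnW.
Qed.

Lemma reduction_idempotent_power x :
  exists2 N, (0 < N)%N & phi (x ^+ N * x ^+ N) = phi (x ^+ N).
Proof.
have [i [d [d_gt0 xid]]] := reduction_pigeonhole (GRing.exp x).
(* The powers of [x] have period [d] from exponent [i] on; this exponent is a multiple of [d] and at
   least [i], so doubling it changes nothing. *)
exists (d * i.+1)%N; first by rewrite muln_gt0 d_gt0.
have step k m : phi (x ^+ (i + k + d * m)) = phi (x ^+ (i + k)).
  elim: m => [|m IHm]; first by rewrite muln0 addn0.
  rewrite mulnS addnCA addnC -addnA -[(i + k + _)%N]addnA [X in x ^+ X](_ : _ = (i + d + (k + d * m)))%N; last by ring.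
  by rewrite exprD -(reduction_mull _ xid) -exprD addnA IHm.
rewrite -exprD; have lt_iN : (i <= d * i.+1)%N.
  by rewrite (leq_trans (leqnSn i))// leq_pmull.
by rewrite -{1 3}(subnKC lt_iN) step.
Qed.

(** * Primes above [p] and their local idempotents *)

Section PrimeIdeal.
Variable P : prime_idealr R.
Hypothesis pP : p%:R \in P.

Lemma mem_reduction x y : phi x = phi y -> (x \in P) = (y \in P).
Proof.
move=> xy; have : phi (x - y) = 0 by rewrite raddfB xy subrr.
case/phi_ker=> z xyz; have xyP : x - y \in P by rewrite xyz mulrC idealMr.
by rewrite -[x](subrK y) rpredDl.
Qed.

Lemma mem_reduction0 x : phi x = 0 -> x \in P.
Proof. by rewrite -(raddf0 phi) => /mem_reduction ->; rewrite rpred0. Qed.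

(** [e] is the product, over all residue classes outside [P], of their idempotent powers; hence
    every [z] outside [P] divides [e] mod [p]. For [u] in [P] with [u ^+ k] idempotent, [1 - u ^+ k]
    is outside [P], so it divides [e], and it kills [u ^+ k]. *)
Lemma local_idempotent : exists e, [/\ e \notin P, phi (e * e) = phi e,
  forall z, z \notin P -> exists t, phi (z * t) = phi e &
  forall u, u \in P -> exists N, phi (e * u ^+ N) = 0].
Proof.
pose N v := s2val (cid2 (reduction_idempotent_power (sec v))).
have N_gt0 v : (0 < N v)%N := s2valP (cid2 (reduction_idempotent_power (sec v))).
have idemN v : phi (sec v ^+ N v * sec v ^+ N v) = phi (sec v ^+ N v).
  exact: s2valP' (cid2 (reduction_idempotent_power (sec v))).
clearbody N; pose e := \prod_(v | sec v \notin P) sec v ^+ N v.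
have expP x k : x \notin P -> x ^+ k \notin P.
  move=> xP; elim: k => [|k IHk]; first by rewrite idealr1.
  by rewrite exprS prime_idealrM negb_or xP.
have eP : e \notin P.
  rewrite /e; elim/big_rec: _ => [|v x vP xP]; first by rewrite idealr1.
  by rewrite prime_idealrM negb_or xP expP.
have ez z : z \notin P -> exists t, phi (z * t) = phi e.
  move=> zP; have vP : sec (phi z) \notin P by rewrite (mem_reduction (secK _)).
  exists (sec (phi z) ^+ (N (phi z)).-1 * \prod_(v | (sec v \notin P) && (v != phi z)) sec v ^+ N v).
  rewrite /e [in RHS](bigD1 (phi z))//=.
  rewrite -[in RHS](prednK (N_gt0 (phi z))) exprS -[in RHS]mulrA.
  by apply: reduction_mull; rewrite secK.
exists e; split=> //; last (move=> u uP).
  rewrite /e; elim/big_ind: _ => [|x y xx yy|v _]; rewrite ?mulr1 ?idemN//.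
  by rewrite mulrACA (reduction_mull _ xx) (reduction_mulr _ yy).
have [k k_gt0 uk] := reduction_idempotent_power u.
have ukP : 1 - u ^+ k \notin P.
  apply/negP => H; have := idealr1 P; rewrite -[1](subrK (u ^+ k)).
  by rewrite rpredD// -(prednK k_gt0) exprSr idealMr.
have [t et] := ez _ ukP; exists k.
rewrite -(reduction_mull _ et) [_ * t]mulrC -mulrA mulrBl mul1r.
by apply: etrans (reduction_mulr _ (_ : phi _ = phi 0)) _; rewrite ?mulr0 ?raddf0// raddfB uk subrr.
Qed.

(** If [z * t] reduces to [e], then [e * (z * t - 1)] is divisible by [p], hence in [P], while [e]
    is not. *)
Lemma residue_inverse z : z \notin P -> exists s, z * s - 1 \in P.
Proof.
have [e [eP ee ez _]] := local_idempotent => /ez[t zt]; exists t.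
have : e * (z * t - 1) \in P.
  rewrite (mem_reduction (y := 0)) ?rpred0// raddf0 mulrBr raddfB mulr1.
  by rewrite (reduction_mulr _ zt) ee subrr.
by rewrite prime_idealrM (negPf eP).
Qed.

End PrimeIdeal.

(** Choose [x * r] generating a minimal nonzero ideal of [R/pR]; minimality is
    measured by the rank of its multiplication matrix. *)
Lemma prime_annihilator x : phi x != 0 ->
  exists2 r, phi (x * r) != 0 &
    exists Q : prime_idealr R, forall a, (a \in Q) = (phi (x * r * a) == 0).
Proof.
move=> x0; pose S k := `[< exists2 r, phi (x * r) != 0 & \rank (mulmat (x * r)) = k >].
have exS : exists k, S k.
  by exists (\rank (mulmat x)); apply/asboolP; exists 1; rewrite mulr1.
case: (ex_minnP exS) => k /asboolP[r xr0 rk] kmin; exists r => //.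
set y := x * r in xr0 rk *.
pose Q : {pred R} := fun a => phi (y * a) == 0.
have Qz : zmod_closed Q.
  split=> [|a b /eqP ya /eqP yb]; rewrite unfold_in ?mulr0 ?raddf0//.
  by rewrite mulrBr raddfB ya yb subrr.
have Qi : 1 \notin Q /\ forall a, {in Q, forall u, a * u \in Q}.
  split=> [|a u /eqP yu]; rewrite unfold_in ?mulr1//.
  by rewrite mulrCA mulrC reduction_mul0.
have Qp : prime_idealr_closed Q.
  move=> a b /eqP yab; case: (boolP (a \in Q)) => //= ya.
  rewrite unfold_in -/(Q a) in ya.
  (* Since [y * a] is nonzero mod [p], minimality makes it generate the same ideal as [y]; so [y] is
     a multiple of [y * a], and [y * b] vanishes along with [y * (a * b)]. *)
  have sub : (mulmat (y * a) <= mulmat y)%MS by rewrite mulrC mulmatM submxMl.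
  have : (mulmat y <= mulmat (y * a))%MS.
    rewrite -(geq_leqif (mxrank_leqif_sup sub)) rk; apply: kmin.
    by apply/asboolP; exists (r * a); rewrite mulrA.
  move=> /(submx_trans (submxMl (phi 1) (mulmat y))).
  rewrite -reductionM mul1r => /submxP[v yv].
  apply/eqP; rewrite -(secK v) -reductionM in yv.
  rewrite (reduction_mull _ yv) (_ : _ * b = y * (a * b) * sec v); last by ring.
  by rewrite reduction_mul0.
pose c1 := GRing.isZmodClosed.Build _ Q Qz.
pose c2 := isProperIdeal.Build _ Q Qi.
pose c3 := isPrimeIdealrClosed.Build _ Q Qp.
pose Q' : prime_idealr R := HB.pack Q c1 c2 c3.
by exists Q'.
Qed.

(** Some multiple [e * r] has a prime annihilator [Q]. As [e] is idempotent, it is not in [Q]; as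
    [e * u ^+ N] vanishes mod [p], every [u] in [P] is in [Q]. *)
Lemma local_annihilator (P : prime_idealr R) : p%:R \in P ->
  exists2 w, phi w != 0 & forall u, u \in P -> phi (w * u) = 0.
Proof.
move=> pP; have [e [eP ee ez eu]] := local_idempotent pP.
have [|r er0 [Q Qe]] := @prime_annihilator e.
  by apply: contra eP => /eqP/(mem_reduction0 pP).
exists (e * r) => // u uP; apply/eqP; rewrite -Qe.
have [N euN] := eu u uP.
have : e * u ^+ N \in Q by rewrite Qe mulrC reduction_mul0.
have /negPf eQ : e \notin Q by rewrite Qe mulrAC (reduction_mull _ ee).
rewrite prime_idealrM eQ /=; elim: (N) => [|k IHk].
  by rewrite expr0 idealr1.
by rewrite exprS prime_idealrM => /orP[].
Qed.

Lemma natr_mem_prime (P : prime_idealr R) m : p%:R \in P -> (m%:R \in P) = (p %| m)%N.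
Proof.
move=> pP; apply/idP/idP => [mP|/dvdnP[k ->]]; last by rewrite natrM idealMr.
apply: contraT; rewrite -prime_coprime// => /coprimeP-/(_ (prime_gt0 p_prime))[[a b] /= ab].
have := idealr1 P; rewrite -(mulr1n 1) -ab natrB ?natrM; last by rewrite ltnW// -subn_gt0 ab.
by rewrite rpredB// idealMr.
Qed.

Lemma residue_scalar_lift (P : prime_idealr R) :
    (forall x, exists j : int, x - j%:~R \in P) -> p%:R \in P ->
  forall x, exists j : nat, x - j%:R \in P.
Proof.
move=> resP pP x; have [j jP] := resP x; exists `|(j %% p)%Z|%N.
have jE : j%:~R = (j %/ p)%Z%:~R * p%:R + (j %% p)%Z%:~R :> R.
  by rewrite {1}(divz_eq j p) rmorphD rmorphM.
rewrite pmulrn gez0_abs ?modz_ge0//; last by rewrite eqz_nat -lt0n prime_gt0.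
rewrite (_ : x - _ = (x - j%:~R) + (j %/ p)%Z%:~R * p%:R); last by rewrite jE; ring.
by rewrite rpredD// idealMr.
Qed.

(** * The radical of the trace form *)

Definition trace_radical x := forall y, \tr (mulmat (x * y)) = 0.

Lemma trace_radical_nilpotent x N : phi (x ^+ N) = 0 -> trace_radical x.
Proof.
move=> xN y; apply: (@mxtrace_nilpotent _ N).
by rewrite -mulmatX exprMn; apply/mulmat_inj; rewrite reduction_mul0.
Qed.

(** Iterated Frobenius is eventually periodic on [x], so [y = x^(p^d) - x] satisfies [y^(p^i) = 0]
    mod [p] for some [i]; the factor cut out by [f] is reduced, whence [f * y = 0] there. *)
Lemma frobenius_reduced f x : phi (f * f) = phi f ->
    (forall y, phi (f * (y * y)) = 0 -> phi (f * y) = 0) ->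
  exists2 c, (0 < c)%N & phi (f * x ^+ (p ^ c)) = phi (f * x).
Proof.
move=> ff fred; have [i [d [d_gt0 xid]]] := reduction_pigeonhole (fun k => x ^+ (p ^ k)).
exists d => //; pose y := x ^+ (p ^ d) - x.
suff : phi (f * y) = 0.
  by move=> /eqP; rewrite mulrBr raddfB subr_eq0 => /eqP.
have redX k z : phi (f * z ^+ (2 ^ k)) = 0 -> phi (f * z) = 0.
  elim: k z => [|k IHk] z; first by rewrite expr1.
  by rewrite expnSr exprM expr2 => /fred/IHk.
(* [redX] handles only exponents that are powers of two, so [p ^ i] is enlarged to [2 ^ (p ^ i)]. *)
apply: (redX (p ^ i)%N); have le : (p ^ i <= 2 ^ p ^ i)%N by rewrite ltnW// ltn_expl.
rewrite -(subnKC le) exprD mulrA reduction_mul0// mulrC reduction_mul0//.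
have addp a b : phi ((a + b) ^+ p) = phi (a ^+ p + b ^+ p).
  rewrite exprDn (bigD1 ord0)//= (bigD1 ord_max)/=; last first.
    by rewrite -(inj_eq val_inj)/= -lt0n prime_gt0.
  rewrite !subn0 subnn !expr0 !mulr1 !mul1r bin0 binn !mulr1n addrA raddfD.
  rewrite raddf_sum big1 ?addr0// => k /andP[k0 kp].
  have /dvdnP[q ->] : (p %| 'C(p, k))%N.
    apply: prime_dvd_bin => //; rewrite lt0n -[0%N]/(val (@ord0 p)) k0 /=.
    by rewrite ltn_neqAle -ltnS ltn_ord andbT; apply: contra kp.
  by rewrite mulrnA -mulr_natl reduction_p.
have powp a b k : phi a = phi b -> phi (a ^+ k) = phi (b ^+ k).
  move=> ab; elim: k => [//|k IHk].
  by rewrite !exprS (reduction_mull _ ab) (reduction_mulr _ IHk).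
have addpi a b k : phi ((a + b) ^+ (p ^ k)) = phi (a ^+ (p ^ k) + b ^+ (p ^ k)).
  elim: k => [|k IHk]; first by rewrite !expr1.
  by rewrite expnSr !exprM (powp _ _ _ IHk) addp.
have : phi ((y + x) ^+ (p ^ i)) = phi (x ^+ (p ^ i)).
  by rewrite subrK -exprM -expnD addnC -xid.
by rewrite addpi raddfD => /(canRL (addrK _)); rewrite subrr.
Qed.

(** By [frobenius_reduced], multiplications on the factor cut out by [f] satisfy the hypotheses of
    [trace_form_nondegenerate], so its trace form has no radical. *)
Lemma trace_radical_reduced f x : phi (f * f) = phi f ->
    (forall y, phi (f * (y * y)) = 0 -> phi (f * y) = 0) ->
  trace_radical x -> phi (f * x) = 0.
Proof.
move=> ff fred xrad.
pose E := mulmat f.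
have EE : E *m E = E by rewrite -mulmatM; apply: mulmat_eq.
have [r [B [C [CB BC]]]] : exists r (B : 'M_(r, n)) (C : 'M_(n, r)),
    C *m B = E /\ B *m C = 1%:M.
  exists (\rank E), (row_base E), (col_base E).
  by split; [exact: mulmx_base | exact: mul_row_col_base].
(* The matrix of multiplication by [y] on the factor cut out by [f], in the basis given by the rows
   of [B]. *)
pose N y := B *m mulmat y *m C.
have comE y z : mulmat y *m mulmat z = mulmat z *m mulmat y.
  by rewrite -!mulmatM mulrC.
have NM y z : N (y * z) = N y *m N z.
  have -> : N y *m N z = B *m (mulmat y *m E) *m (mulmat z *m C).
    by rewrite -CB /N !mulmxA.
  by rewrite comE -/E -CB !mulmxA BC mul1mx /N mulmatM mulmxA.
have N1 : N 1 = 1%:M by rewrite /N mulmat1 mulmx1.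
have NX y k : N (y ^+ k) = N y ^+ k.
  by elim: k => [|k IHk]; rewrite ?N1// !exprS NM IHk.
have ENE y : E *m mulmat y *m E = mulmat (f * y).
  by rewrite -mulmxA comE -/E mulmxA EE mulmatM.
have N_eq y z : phi (f * y) = phi (f * z) -> N y = N z.
  have NE u : N u = B *m (E *m mulmat u *m E) *m C.
    by rewrite -CB !mulmxA BC mul1mx -mulmxA BC mulmx1.
  by rewrite !NE !ENE => /mulmat_eq ->.
have N_eq0 y : N y = 0 -> phi (f * y) = 0.
  move=> Ny; apply/mulmat_inj; rewrite -ENE -CB.
  have -> : C *m B *m mulmat y *m (C *m B) = C *m N y *m B by rewrite /N !mulmxA.
  by rewrite Ny mulmx0 mul0mx.
have trN y : \tr (N y) = \tr (mulmat (f * y)).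
  by rewrite /N mxtrace_mulC mulmxA CB -mulmatM.
have ND y z : N (y + z) = N y + N z by rewrite /N mulmatD mulmxDr mulmxDl.
have N0 : N 0 = 0 by rewrite /N mulmat0 mulmx0 mul0mx.
have N_sum (I : finType) (F : I -> R) : N (\sum_i F i) = \sum_i N (F i).
  by elim/big_rec2: _ => // i y1 y2 _ <-; rewrite ND.
have N_scale (a : 'F_p) y : N (a%:R * y) = a *: N y.
  have aE : mulmat (a%:R * y) = a *: mulmat y.
    apply/matrixP => i j.
    by rewrite !mxE mulrCA mulr_natl raddfMn mulmxnE -mulr_natl natr_Zp.
  by rewrite /N aE -scalemxAr -scalemxAl.
pose s i := sec (row i B).
have fs (v : 'rV['F_p]_r) : phi (f * \sum_i (v 0 i)%:R * s i) = v *m B.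
  rewrite mulrC reductionM raddf_sum.
  have -> : \sum_i phi ((v 0 i)%:R * s i) = v *m B.
    rewrite mulmx_sum_row; apply: eq_bigr => i _.
    by rewrite -(secK (row i B)) scale_reduction mulr_natl.
  by rewrite -/E -CB mulmxA -(mulmxA v) BC mulmx1.
pose v := phi x *m C.
have fx : phi (f * x) = v *m B by rewrite mulrC reductionM -/E -CB mulmxA.
rewrite fx; suff -> : v = 0 by rewrite mul0mx.
have Scomm i j : N (s i) *m N (s j) = N (s j) *m N (s i) by rewrite -!NM mulrC.
have Spow i : exists2 c, (0 < c)%N & N (s i) ^+ (p ^ c) = N (s i).
  have [c c_gt0 fc] := frobenius_reduced (s i) ff fred.
  by exists c; rewrite // -NX; apply: N_eq.
have Sfree (u : 'rV_r) : \sum_i u 0 i *: N (s i) = 0 -> u = 0.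
  under eq_bigr do rewrite -N_scale.
  rewrite -N_sum => /N_eq0; rewrite fs => uB.
  by rewrite -[u]mulmx1 -BC mulmxA uB mul0mx.
apply: (trace_form_nondegenerate p_prime Scomm Spow Sfree) => j.
under eq_bigr do rewrite -mxtraceZ scalemxAl -N_scale.
rewrite -raddf_sum -mulmx_suml -N_sum.
have -> : N (\sum_i (v 0 i)%:R * s i) = N x by apply: N_eq; rewrite fs fx.
rewrite -NM /= trN (_ : f * (x * s j) = x * (f * s j)); last by ring.
exact: xrad.
Qed.

Hypothesis p_reg : forall x y : R, p%:R * x = p%:R * y -> x = y.
(** Integral closedness in the form given by the determinant trick: [w/p] maps the ideal [I] into
    itself, hence lies in [R]. *)
Hypothesis integrally_closed : forall (I : R -> Prop) w,
  I p%:R -> (forall x y, I x -> I y -> I (x + y)) -> (forall a x, I x -> I (a * x)) ->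
  (forall x, I x -> exists2 t, I t & w * x = p%:R * t) -> phi w = 0.

(** * Invertibility of the primes above [p] *)

Section DedekindPrime.
Variables (P : prime_idealr R) (pP : p%:R \in P).
Variables (w : R) (w0 : phi w != 0) (wP : forall u, u \in P -> phi (w * u) = 0).

(** Otherwise [w/p] would map [P] into itself, and [p] would divide [w]. *)
Lemma uniformizer : exists pi k, [/\ pi \in P, w * pi = p%:R * k & k \notin P].
Proof.
apply: contrapT => noU; case/eqP: w0.
apply: (@integrally_closed (fun x => x \in P)) => //.
- by move=> x y; apply: rpredD.
- by move=> a x; apply: idealMr.
move=> x xP; have /phi_ker[t wx] := wP xP; exists t => //.
by apply: contrapT => /negP tP; apply: noU; exists x, t.
Qed.

Lemma annihilator_exp s x : x \in ideal_exp P s -> exists t, w ^+ s * x = p%:R ^+ s * t.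
Proof.
elim: s x => [|s IHs] x; first by exists x.
elim/ideal_mul_ind => [|a b [t1 at1] [t2 bt2]|a b aP /IHs[t2 bt]].
- by exists 0; rewrite !mulr0.
- by exists (t1 + t2); rewrite !mulrDr at1 bt2.
have /phi_ker[t1 at1] := wP aP; exists (t1 * t2).
by rewrite !exprS mulrACA at1 bt mulrACA.
Qed.

(** If [p] were in every [P^s], the elements [x] with [(w/p)^s x] in [R] for all [s] would form an
    ideal containing [p] and stable under [w/p], contradicting [w0]. *)
Lemma ord_exists : exists m, is_ord P (principal_ideal p%:R) m.
Proof.
have [s ps] : exists s, p%:R \notin ideal_exp P s.
  apply: contrapT => pPs; case/eqP: w0.
  have {}pPs s : p%:R \in ideal_exp P s.
    by apply: contrapT => /negP ps; apply: pPs; exists s.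
  apply: (@integrally_closed (fun x => forall s, exists t, w ^+ s * x = p%:R ^+ s * t)).
  - by move=> s; apply: annihilator_exp.
  - move=> x y xI yI s; have [[t1 xt] [t2 yt]] := (xI s, yI s).
    by exists (t1 + t2); rewrite !mulrDr xt yt.
  - by move=> a x xI s; have [t xt] := xI s; exists (a * t); rewrite mulrCA xt mulrCA.
  move=> x xI; have [t] := xI 1; rewrite !expr1 => xt; exists t => // s.
  have [t' xt'] := xI s.+1; exists t'; apply: p_reg.
  by rewrite mulrCA -xt [LHS]mulrA -exprSr xt' exprS mulrA.
pose S k := p%:R \in ideal_exp P k.
have S0 : exists k, S k by exists 0.
have Sle k : S k -> (k <= s)%N.
  move=> Sk; rewrite leqNgt; apply: contra ps => /ltnW sk.
  exact: ideal_exp_le sk _ Sk.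
case: (ex_maxnP S0 Sle) => m Sm mmax; exists m; split=> [|k].
  exact/principal_ideal_sub.
by move/principal_ideal_sub/mmax.
Qed.

(** If [w] were in [P], then [p * k = w * pi] would be in [P^2], and [p] too since [k] is invertible
    modulo [P]. *)
Lemma annihilator_unit : p%:R \notin ideal_exp P 2 -> w \notin P.
Proof.
apply: contra => wPP; have [pi [k [piP wpi kP]]] := uniformizer.
have [s ks] := residue_inverse pP kP.
rewrite (_ : p%:R = s * (w * pi) - (k * s - 1) * p%:R); last by rewrite wpi; ring.
apply: ideal_expD; first by rewrite ideal_expMl// mem_ideal_exp2.
by rewrite -mulNr mem_ideal_exp2// rpredN.
Qed.

(** [w/p] maps [P^(s+1)] into [P^s], and it maps [p] to [w]. *)
Lemma mem_annihilator s : p%:R \in ideal_exp P s.+1 -> w \in ideal_exp P s.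
Proof.
suff H x : x \in ideal_exp P s.+1 -> exists2 y, y \in ideal_exp P s & w * x = p%:R * y.
  by case/H=> y yP; rewrite mulrC => /p_reg ->.
elim/ideal_mul_ind => [|a b [t1 t1P at1] [t2 t2P bt2]|a b aP bP].
- by exists 0; rewrite ?mem_ideal_exp0// !mulr0.
- by exists (t1 + t2); rewrite ?ideal_expD// !mulrDr at1 bt2.
have /phi_ker[t1 at1] := wP aP; exists (t1 * b); first exact: ideal_expMl.
by rewrite mulrA at1 mulrA.
Qed.

(** Take [z = w^2/p]: then [z u v = p (w u / p) (w v / p)]. If [z] were in [P], then
    [k^2 p = z pi^2] would be in [P^3], and so would [p]. *)
Lemma annihilator_square : p%:R \in ideal_exp P 2 -> p%:R \notin ideal_exp P 3 ->
  exists2 z, z \notin P & forall u v, u \in P -> v \in P -> phi (z * u * v) = 0.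
Proof.
move=> p2 p3; have wPP : w \in P by rewrite -ideal_exp1 mem_annihilator.
have /phi_ker[z wwz] := wP wPP; exists z => [|u v uP vP]; last first.
  have [/phi_ker[t1 ut] /phi_ker[t2 vt]] := (wP uP, wP vP).
  apply/phi_ker; exists (t1 * t2); apply: p_reg.
  have -> : p%:R * (z * u * v) = p%:R * z * u * v by ring.
  rewrite -wwz (_ : w * w * u * v = w * u * (w * v)); last by ring.
  by rewrite ut vt; ring.
apply: contra p3 => zP; have [pi [k [piP wpi kP]]] := uniformizer.
have kpz : k * k * p%:R = z * (pi * pi).
  apply: p_reg; have -> : p%:R * (k * k * p%:R) = p%:R * k * (p%:R * k) by ring.
  by rewrite -wpi [RHS]mulrA -wwz; ring.
have kkP : k * k \notin P by rewrite prime_idealrM (negPf kP).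
have [s ks] := residue_inverse pP kkP.
rewrite (_ : p%:R = s * (z * (pi * pi)) - (k * k * s - 1) * p%:R); last first.
  by rewrite -kpz; ring.
apply: ideal_expD; last by rewrite -mulNr mem_ideal_mul// rpredN.
apply: ideal_expMl; rewrite mulrA.
by rewrite mulrC mem_ideal_mul// mulrC mem_ideal_exp2.
Qed.

End DedekindPrime.

(** * The local factor at a ramified prime *)

Section RamifiedPrime.
Variables (P : prime_idealr R) (pP : p%:R \in P) (p2 : p%:R \in ideal_exp P 2).
Variables (e : R) (eP : e \notin P) (ee : phi (e * e) = phi e).
Hypothesis ez : forall z, z \notin P -> exists t, phi (z * t) = phi e.
Hypothesis eu : forall u, u \in P -> exists N, phi (e * u ^+ N) = 0.
Variables (w : R) (w0 : phi w != 0) (wP : forall u, u \in P -> phi (w * u) = 0).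
Variables (pi k : R) (piP : pi \in P) (wpi : w * pi = p%:R * k) (kP : k \notin P).

(** From [e * pi = p * r] would follow [e * k = w * r]; but [w] is in [P] because [p] is in [P^2],
    and neither [e] nor [k] is in [P]. *)
Lemma local_uniformizer_neq0 : phi (e * pi) != 0.
Proof.
apply/eqP => /phi_ker[r epi].
have : e * k = w * r by apply: p_reg; rewrite mulrCA -wpi mulrCA epi; ring.
move/(congr1 (mem P)); rewrite !inE; apply/eqP; rewrite !prime_idealrM.
by rewrite (negPf eP) (negPf kP) eq_sym eqbF_neg negbK -ideal_exp1 mem_annihilator.
Qed.

Lemma trace_radical_local u : u \in P -> trace_radical (e * u).
Proof.
move=> uP; have [N euN] := eu uP; apply: (@trace_radical_nilpotent _ N.+1).
rewrite (_ : _ ^+ _ = e * u ^+ N * (e ^+ N * u)); first exact: reduction_mul0.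
by rewrite exprMn !exprS; ring.
Qed.

(** Writing [w * u = p * t] gives [k * u = t * pi], and [k] is invertible on the local factor. *)
Lemma local_principal u : u \in P -> exists a, phi (e * u) = phi (e * (a * pi)).
Proof.
move=> uP; have /phi_ker[t wu] := wP uP; have [s ks] := ez kP.
exists (s * t); rewrite -!mulrA.
have kut : k * u = t * pi.
  by apply: p_reg; rewrite mulrA -wpi mulrAC wu; ring.
have -> : phi (e * u) = phi (e * (e * u)).
  by rewrite mulrA -(reduction_mull u ee).
apply: reduction_mulr; rewrite -(reduction_mull u ks).
rewrite (_ : k * s * u = s * (k * u)); last by ring.
by rewrite kut mulrA.
Qed.

Hypothesis resP : forall x, exists j : nat, x - j%:R \in P.

Lemma trace_local : (forall u, u \in P -> trace_radical (e * u)) ->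
  forall y, exists j : nat, \tr (mulmat (e * y)) = j%:R * \tr (mulmat e).
Proof.
move=> erad y; have [j yj] := resP y; exists j.
rewrite -[y in LHS](subrK j%:R) mulrDr mulmatD raddfD /=.
have := erad _ yj 1; rewrite mulr1 => ->; rewrite add0r.
elim: (j) => [|i IHi]; first by rewrite mulr0 mulmat0 mxtrace0 mul0r.
by rewrite -[in LHS]natr1 mulrDr mulr1 mulmatD mxtraceD IHi -natr1 mulrDl mul1r.
Qed.

Hypothesis eP2 : forall u v, u \in P -> v \in P -> phi (e * u * v) = 0.

(** A basis of the local factor is [e], [e * pi]: an element is an integer plus a multiple of [pi],
    whose coefficient matters only modulo [P] because [e P^2 = 0]. *)
Lemma rank_local : \rank (mulmat e) = 2.
Proof.
have neq0 := local_uniformizer_neq0.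
pose B := col_mx (phi e) (phi (e * pi)).
have span x : exists v, phi (e * x) = v *m B.
  have [j xj] := resP x; have [a xa] := local_principal xj.
  have [i ai] := resP a.
  have ia : phi (e * (a * pi)) = phi (e * (i%:R * pi)).
    apply/eqP; rewrite -subr_eq0 -raddfB /=; apply/eqP.
    by rewrite -(eP2 ai piP); congr (phi _); ring.
  exists (row_mx j%:R%:M i%:R%:M); rewrite mul_row_col !mul_scalar_mx !scaler_nat.
  rewrite -(subrK j%:R x) mulrDr raddfD xa ia addrC -!raddfMn.
  by congr (phi _ + phi _); rewrite -mulr_natr; ring.
have rB : row_free B.
  rewrite -kermx_eq0; apply/eqP/row_matrixP => l; rewrite row0.
  have /sub_kermxP := row_sub l (kermx B); move: (row l _) => v.
  rewrite -[v]hsubmxK mul_row_col [lsubmx v]mx11_scalar [rsubmx v]mx11_scalar.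
  rewrite !mul_scalar_mx; move: (lsubmx v 0 0) (rsubmx v 0 0) => a b.
  rewrite !scale_reduction -raddfD => ab.
  (* Reducing the relation modulo [P] leaves only the term in [e]. *)
  have a0 : a = 0.
    have /(mem_reduction0 pP) : phi (e *+ a + e * pi *+ b) = 0 := ab.
    rewrite rpredDr; last by rewrite rpredMn// idealMr.
    rewrite -mulr_natr prime_idealrM (negPf eP) natr_mem_prime//.
    move=> pa; rewrite -[a]natr_Zp; apply/eqP.
    by have := pchar_Fp p_prime => /dvdn_pcharf <-.
  move: ab; rewrite a0 mulr0n add0r -scale_reduction => /eqP.
  by rewrite scaler_eq0 (negPf neq0) orbF => /eqP ->; rewrite -scalemx1 scale0r row_mx0.
have <- : \rank B = 2 by move: rB; rewrite /row_free => /eqP.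
apply/eqP; rewrite eqn_leq; apply/andP; split; apply: mxrankS.
  apply/row_subP => i; rewrite rowK mulrC; have [v ->] := span (sec (delta_mx 0 i)).
  exact: submxMl.
rewrite col_mx_sub; apply/andP; split.
  by rewrite -{1}[e]mul1r reductionM submxMl.
by rewrite mulrC reductionM submxMl.
Qed.

End RamifiedPrime.

(** * Ramified primes and the annihilator of the radical *)

Lemma intr_mem_prime (P : prime_idealr R) (i : int) : p%:R \in P ->
  (i%:~R \in P) = (p %| `|i|)%N.
Proof.
move=> pP; rewrite -(natr_mem_prime _ pP); case: i => m //.
by rewrite NegzE rmorphN /= rpredN.
Qed.

Definition annihilates_radical x := forall u, trace_radical u -> phi (x * u) = 0.

Lemma annihilates_radicalD x y :
  annihilates_radical x -> annihilates_radical y -> annihilates_radical (x + y).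
Proof. by move=> xrad yrad u urad; rewrite mulrDl raddfD xrad// yrad// addr0. Qed.

Lemma annihilates_radicalMl a x : annihilates_radical x -> annihilates_radical (a * x).
Proof. by move=> xrad u urad; rewrite -mulrA mulrC reduction_mul0// xrad. Qed.

Lemma mxtrace_local_neq0 (E : 'M['F_p]_n) : \rank E = 2 -> E *m E = E -> odd p -> \tr E != 0.
Proof.
move=> rE EE p_odd; rewrite (mxtrace_idempotent EE) rE -(dvdn_pcharf (pchar_Fp p_prime)).
by apply: contraL p_odd => /(prime_nt_dvdP _ _) -> //; case: (p) p_prime => [|[]].
Qed.

(** The first hypothesis says that [g] generates the additive group of [R] modulo the annihilator of
    the radical. *)
Lemma ramified_of_cyclic g (P : prime_idealr R) :
    (forall x, exists i : int, annihilates_radical (x - g *~ i)) ->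
    p%:R \in P -> p%:R \in ideal_exp P 2 ->
  [/\ odd p, p%:R \notin ideal_exp P 3,
      forall x, x \in P <-> annihilates_radical x &
      forall x, exists j : nat, x - j%:R \in P].
Proof.
move=> gD pP p2.
have [e [eP ee ez eu]] := local_idempotent pP.
have [w w0 wP] := local_annihilator pP.
have [pi [k [piP wpi kP]]] := uniformizer pP w0 wP.
have epi0 := local_uniformizer_neq0 p2 eP wP wpi kP.
have erad u : u \in P -> trace_radical (e * u) by apply: trace_radical_local.
(* An [x] outside [P] divides [e] mod [p]; if it killed the radical element [e * pi], so would [e],
   against [epi0]. *)
have DP x : annihilates_radical x -> x \in P.
  move=> xD; apply: contraT => /ez[t xt]; case/eqP: epi0.
  rewrite -(reduction_mull pi ee) -(mulrA e) -(reduction_mull (e * pi) xt).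
  by rewrite mulrAC reduction_mul0// xD//; apply: erad.
have gP : g \notin P.
  apply/negP => gP; have [i /DP iP] := gD 1; have := idealr1 P.
  by rewrite -[1](subrK (g *~ i)) rpredD// -mulrzr mulrC idealMr.
(* Modulo the annihilator [x] is [g *~ i], which is in [P] while [g] is not; so [p] divides [i]. *)
have PD x : x \in P -> annihilates_radical x.
  move=> xP; have [i xi] := gD x.
  rewrite -[x](subrK (g *~ i)); apply: annihilates_radicalD => //.
  have : g *~ i \in P by rewrite -[g *~ i](subKr x) rpredB// DP.
  rewrite -mulrzr prime_idealrM (negPf gP) intr_mem_prime//= => /dvdnP[q iq] u _.
  apply/phi_ker; exists (g * (sgz i * q)%:~R * u).
  by rewrite [X in _ *~ X]intEsg iq PoszM -mulrzr !rmorphM /=; ring.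
have resP : forall x, exists j : nat, x - j%:R \in P.
  apply: residue_scalar_lift => // x.
  have [[i0 /DP i0P] [i /DP iP]] := (gD 1, gD x).
  have i0p : ~~ (p %| `|i0|)%N.
    rewrite -(intr_mem_prime _ pP); apply/negP => i0P'; have := idealr1 P.
    by rewrite -[1](subrK (g *~ i0)) rpredD// -mulrzr idealMr.
  (* Modulo [P], [1] is [g *~ i0] and [x] is [g *~ i]; with [a] inverse to [i0] modulo [p], [x] is
     congruent to [i * a]. *)
  have [a [b]] := Bezoutz i0 p.
  have -> : gcdz i0 p = 1.
    by apply/eqP; rewrite -[_ == _]/(coprime `|i0| p) coprime_sym prime_coprime.
  move=> /(congr1 (fun c : int => c%:~R : R)).
  rewrite rmorphD !rmorphM /= => abR; exists (i * a).
  have comb (G I I0 A B q : R) : A * I0 + B * q = 1 ->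
      x - I * A = (x - G * I) + G * (I * B) * q - I * A * (1 - G * I0).
    by move=> h; rewrite -[G * I]mulr1 -{1}h; ring.
  rewrite rmorphM /= (comb g _ _ _ _ _ abR) (mulrzr g i) (mulrzr g i0).
  by apply: rpredB; [apply: rpredD => // |]; apply: idealMr.
have eP2 u v : u \in P -> v \in P -> phi (e * u * v) = 0.
  by move=> /PD uD vP; rewrite mulrAC mulrC uD//; apply: erad.
split=> //; last by move=> x; split; [exact: PD | exact: DP].
  apply: contraT => p_even; have p_eq2 : p = 2 by case: (even_prime p_prime) p_even => [|->].
  have E2 := rank_local pP p2 eP ee ez wP piP wpi kP resP eP2.
  (* For [p = 2] the trace of [e] vanishes, so [e] is in the radical and [pi] kills it. *)
  have tr0 : \tr (mulmat e) = 0.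
    rewrite (mxtrace_idempotent _) ?E2; last by rewrite -mulmatM; apply: mulmat_eq.
    by apply/eqP; rewrite -(dvdn_pcharf (pchar_Fp p_prime)) p_eq2.
  case/eqP: epi0; rewrite mulrC (PD _ piP)// => y.
  have [j ->] := trace_local resP erad y.
  by rewrite tr0 mulr0.
(* If [p] is in [P^3], then [w] is in [P^2], so [e * w = p * r] for some [r]; this gives
   [e * k = r * pi], which is in [P]. *)
apply/negP => p3; have wP2 := mem_annihilator wP p3.
have eP2' x : x \in ideal_exp P 2 -> phi (e * x) = 0.
  elim/ideal_mul_ind => [|a b a0 b0|a b aP]; rewrite ?mulr0 ?raddf0//.
    by rewrite mulrDr raddfD a0 b0 addr0.
  by rewrite -/(ideal_exp P 1) ideal_exp1 mulrA; apply: eP2.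
have /phi_ker[r ew] := eP2' w wP2.
have /(congr1 (fun x => x \in P)) : e * k = r * pi.
  by apply: p_reg; rewrite mulrCA -wpi [LHS]mulrA ew mulrA.
by rewrite prime_idealrM (negPf eP) (negPf kP) idealMr.
Qed.

Lemma ramified_annihilates_radical (P : prime_idealr R) :
    odd p -> p%:R \in P -> p%:R \in ideal_exp P 2 -> p%:R \notin ideal_exp P 3 ->
    (forall x, exists j : nat, x - j%:R \in P) ->
    (forall Q : prime_idealr R, p%:R \in Q -> p%:R \in ideal_exp Q 2 -> Q =i P) ->
  forall u, u \in P -> annihilates_radical u.
Proof.
move=> p_odd pP p2 p3 resP uniqP u uP x xrad.
have [e [eP ee ez eu]] := local_idempotent pP.
have [w w0 wP] := local_annihilator pP.
have [pi [k [piP wpi kP]]] := uniformizer pP w0 wP.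
have [z zP z0] := annihilator_square pP w0 wP p2 p3.
have eP2 a b : a \in P -> b \in P -> phi (e * a * b) = 0.
  move=> aP bP; have [t zt] := ez z zP.
  rewrite -mulrA -(reduction_mull (a * b) zt).
  rewrite (_ : z * t * _ = z * a * b * t); last by ring.
  by rewrite reduction_mul0// z0.
pose f := 1 - e.
have fe : phi (f * e) = 0 by rewrite mulrBl mul1r raddfB ee subrr.
have ff : phi (f * f) = phi f.
  by rewrite {2}/f mulrBr mulr1 raddfB fe subr0.
have fred y : phi (f * (y * y)) = 0 -> phi (f * y) = 0.
  (* A nonzero square-zero [f * y] has a multiple with prime annihilator [Q]. Since [f * y] is in
     [Q], it is killed by the element [w'] attached to [Q], so [w'] is in [Q] and [Q] is ramified.
     Then [Q = P], although [e] is in [Q]. *)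
  move=> fyy; apply/eqP; apply: contraT => /prime_annihilator[r fyr [Q Qe]].
  have pQ : p%:R \in Q by rewrite Qe mulrC reduction_p.
  have QP : Q =i P.
    apply: uniqP => //; have [w' w'0 w'Q] := local_annihilator pQ.
    apply: contraT => /(annihilator_unit pQ w'0 w'Q); rewrite Qe => /eqP[].
    rewrite mulrAC reduction_mul0// mulrC w'Q// Qe.
    rewrite (_ : _ * r * _ = f * (y * y) * (f * r)); last by ring.
    by rewrite reduction_mul0.
  have : e \in Q.
    rewrite Qe (_ : _ * r * _ = f * e * (y * r)); last by ring.
    by rewrite reduction_mul0.
  by rewrite QP (negPf eP).
have := trace_radical_reduced ff fred xrad.
rewrite mulrBl mul1r raddfB => /eqP; rewrite subr_eq0 => /eqP xe.
(* Otherwise [e] is a multiple of [x] mod [p], and its trace, which is 2, would vanish. *)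
have xP : x \in P.
  apply: contraT => /ez[t xt].
  have E2 := rank_local pP p2 eP ee ez wP piP wpi kP resP eP2.
  have EE : mulmat e *m mulmat e = mulmat e by rewrite -mulmatM; apply: mulmat_eq.
  by have := mxtrace_local_neq0 E2 EE p_odd; rewrite -(mulmat_eq xt) xrad eqxx.
by rewrite mulrC (reduction_mull u xe) eP2.
Qed.

End ReductionModP.
(** * Traces and integral bases *)

(** The determinant trick: [y] is an eigenvalue of an integer matrix, with eigenvector [u], hence a
    root of its characteristic polynomial. *)
Lemma integral_of_stable (L : fieldType) (T : finType) (u : T -> L) i0
    (a : T -> T -> int) y : u i0 != 0 ->
    (forall i, y * u i = \sum_j (a i j)%:~R * u j) ->
  integralOver (intr : int -> L) y.
Proof.
move=> u0 yu; pose A : 'M[int]_#|T| := \matrix_(j, i) a (enum_val i) (enum_val j).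
exists (char_poly A); first exact: char_poly_monic.
rewrite map_char_poly -eigenvalue_root_char; apply/eigenvalueP.
exists (\row_j u (enum_val j)).
  apply/rowP => i; rewrite !mxE yu (reindex _ (onW_bij _ (@enum_val_bij T))).
  by apply: eq_bigr => j _; rewrite !mxE mulrC.
apply: contraNneq u0 => /rowP/(_ (enum_rank i0)).
by rewrite !mxE enum_rankK => ->.
Qed.

Lemma common_denominator (T : finType) (f : T -> rat) :
  exists2 m : nat, (0 < m)%N & forall i, m%:R * f i \is a Num.int.
Proof.
exists (\prod_i `|denq (f i)|)%N => [|i].
  by apply: prodn_gt0 => i; rewrite absz_gt0 denq_neq0.
rewrite (bigD1 i)//= mulnC natrM -mulrA rpredM ?rpred_nat//.
have -> : `|denq (f i)|%:R = (denq (f i))%:~R :> rat by rewrite pmulrn absz_denq.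
by rewrite mulrC -numqE rpred_int.
Qed.

(** The eigenvalues of [A] are algebraic integers. *)
Lemma mxtrace_int n (A : 'M[rat]_n) (q : {poly int}) : q \is monic ->
  \sum_(i < size q) (q`_i)%:~R *: A ^+ i = 0 -> \tr A \is a Num.int.
Proof.
move=> q_monic; case: n A => [|n] A qA; first by rewrite /mxtrace big_ord0.
pose C := map_mx (ratr : rat -> algC) A.
have [rs Crs] := closed_field_poly_normal (char_poly C).
rewrite (monicP (char_poly_monic C)) scale1r in Crs.
have rs_int z : z \in rs -> z \in Aint.
  rewrite -root_prod_XsubC -Crs -eigenvalue_root_char => /eigenvalueP[v vC v0].
  have vCX i : v *m C ^+ i = z ^+ i *: v.
    elim: i => [|i IHi]; first by rewrite !expr0 mulmx1 scale1r.
    by rewrite exprS mulmxA vC -scalemxAl IHi scalerA -exprS.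
  have pI : map_poly intr q \is a polyOver (Num.int : {pred algC}).
    by apply/polyOverP => i; rewrite coef_map /= rpred_int.
  apply: (root_monic_Aint _ _ pI); last by rewrite monic_map.
  have /(congr1 (fun B => v *m map_mx ratr B)) := qA.
  rewrite map_mx0 mulmx0 map_mx_sum mulmx_sumr.
  have -> : \sum_(i < size q) v *m map_mx ratr ((q`_i)%:~R *: A ^+ i) =
      (map_poly intr q).[z] *: v.
    rewrite horner_coef size_map_poly_id0 ?intr_eq0 ?lead_coef_eq0 ?monic_neq0//.
    rewrite scaler_suml; apply: eq_bigr => i _.
    by rewrite map_mxZ rmorphXn/= -scalemxAr vCX scalerA coef_map/= ratr_int.
  by move/eqP; rewrite scaler_eq0 (negPf v0) orbF => /eqP/rootP.
have trC : \tr C = \sum_(z <- rs) z.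
  have size_rs : size rs = n.+1.
    by apply: succn_inj; rewrite -(size_prod_XsubC rs id) -Crs size_char_poly.
  apply: oppr_inj; rewrite -char_poly_trace// Crs -coefPn_prod_XsubC size_rs//.
(* The trace is rational and a sum of algebraic integers. *)
have : \tr C \in Num.int.
  apply: Cint_rat_Aint; first by rewrite trace_map_mx Crat_rat.
  by rewrite trC big_seq rpred_sum.
rewrite trace_map_mx => /intrP[i]; rewrite -(ratr_int algC) => /fmorph_inj ->.
exact: rpred_int.
Qed.

Section Trace.
Variable K : fieldExtType rat.
Local Notation n := (\dim {:K}).
Local Notation e := (vbasis {:K}).
Local Notation R := (ring_of_integers K).

Let e_basis : basis_of {:K} e := vbasisP _.

Definition coords (x : K) : 'rV[rat]_n := passmx.rVof e x.
Definition of_coords (v : 'rV[rat]_n) : K := passmx.vecof e v.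
Definition regular_mx (x : K) : 'M[rat]_n := passmx.mxof e e (amull x).

Lemma coordsK : cancel coords of_coords. Proof. exact: passmx.rVofK. Qed.
Lemma of_coordsK : cancel of_coords coords. Proof. exact: passmx.vecofK. Qed.

Lemma coords_is_linear : linear coords.
Proof. exact: passmx.rVof_linear. Qed.

HB.instance Definition _ := GRing.isSemilinear.Build rat K 'rV[rat]_n _ coords
  (GRing.semilinear_linear coords_is_linear).

Lemma of_coords_is_linear : linear of_coords.
Proof. exact: passmx.vecof_linear. Qed.

HB.instance Definition _ := GRing.isSemilinear.Build rat 'rV[rat]_n K _ of_coords
  (GRing.semilinear_linear of_coords_is_linear).

Lemma coordsM x y : coords (x * y) = coords y *m regular_mx x.
Proof.
by rewrite /regular_mx /coords -passmx.rVof_app// lfunE.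
Qed.

Lemma regular_mx_is_linear : linear regular_mx.
Proof.
move=> a x y; rewrite /regular_mx; have -> := amull_is_linear a x y.
exact: passmx.mxof_linear.
Qed.

HB.instance Definition _ := GRing.isSemilinear.Build rat K 'M[rat]_n _ regular_mx
  (GRing.semilinear_linear regular_mx_is_linear).

Lemma regular_mx1 : regular_mx 1 = 1%:M.
Proof. by rewrite /regular_mx amull1 passmx.mxof1// (basis_free e_basis). Qed.

Lemma regular_mxM x y : regular_mx (x * y) = regular_mx y *m regular_mx x.
Proof.
apply/row_matrixP => i; rewrite !rowE mulmxA -[delta_mx 0 i]of_coordsK.
by rewrite -!coordsM mulrA.
Qed.

Lemma regular_mxX x i : regular_mx (x ^+ i) = regular_mx x ^+ i.
Proof. by elim: i => [|i IHi]; rewrite ?regular_mx1// exprSr exprS regular_mxM IHi. Qed.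

Lemma trace_is_scalar : scalar (@trace K).
Proof.
move=> a x y; rewrite /trace -!/(regular_mx _) linearP/=.
by rewrite mxtraceD mxtraceZ.
Qed.

HB.instance Definition _ := GRing.isSemilinear.Build rat K rat *%R (@trace K)
  (GRing.semilinear_linear trace_is_scalar).

Lemma trace_integer (x : K) : x \in @integers K -> trace x \is a Num.int.
Proof.
move=> /asboolP[q q_monic qx]; apply: (mxtrace_int q_monic).
rewrite -[RHS](linear0 regular_mx) -(rootP qx).
rewrite horner_coef size_map_poly_id0 ?(monicP q_monic) ?oner_neq0//.
rewrite linear_sum; apply: eq_bigr => i _.
rewrite -regular_mxX -linearZ/=; congr regular_mx.
by rewrite coef_map/= -(rmorph_int (in_alg K)) mulr_algl.
Qed.

Lemma trace1 : trace (1 : K) = n%:R.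
Proof. by rewrite /trace -/(regular_mx 1) regular_mx1 mxtrace1. Qed.

(** Take [y = x^-1]: the trace of 1 is the degree, which is nonzero in [rat]. *)
Lemma trace_nondegenerate (x : K) : (forall y, trace (x * y) = 0) -> x = 0.
Proof.
move=> xy; apply/eqP; apply: contraT => x0; have := xy x^-1.
rewrite mulfV// trace1 => /eqP; rewrite pnatr_eq0 => /eqP.
by have := dim_vline (1 : K); rewrite oner_eq0 => d1 n0; have := dimvS (subvf <[1 : K]>%VS); rewrite d1 n0.
Qed.

Lemma coords_sum (x : K) : x = \sum_i coords x 0 i *: e`_i.
Proof. by rewrite -[LHS]coordsK. Qed.

Lemma coords_basis (i : 'I_n) : coords e`_i = delta_mx 0 i.
Proof. exact: passmx.rVofE. Qed.

Lemma dim_gt0 : (0 < n)%N.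
Proof. exact: adim_gt0. Qed.

(** [m] clears the denominators of [regular_mx x], so [x *+ m] stabilizes the lattice spanned by the
    basis. *)
Lemma integral_multiple (x : K) : exists2 m, (0 < m)%N & x *+ m \in @integers K.
Proof.
have [m m_gt0 mint] := common_denominator (fun ij => regular_mx x ij.1 ij.2).
exists m => //; apply/asboolP.
apply: (@integral_of_stable _ _ (fun i : 'I_n => e`_i) (Ordinal dim_gt0)
  (fun i j => numq (m%:R * regular_mx x i j))).
  apply/eqP => /(congr1 coords); rewrite linear0 coords_basis.
  by move/rowP/(_ (Ordinal dim_gt0)); rewrite !mxE !eqxx => /eqP; rewrite oner_eq0.
move=> i; rewrite mulrnAl [x * _]coords_sum -sumrMnl; apply: eq_bigr => j _.
rewrite coordsM coords_basis -rowE mxE -scaler_nat scalerA.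
by rewrite -[in LHS](numqK (mint (i, j))) scaler_int mulrzl.
Qed.

Lemma common_integral_multiple (T : finType) (f : T -> K) :
  exists2 m, (0 < m)%N & forall i, f i *+ m \in @integers K.
Proof.
pose m i := s2val (cid2 (integral_multiple (f i))).
exists (\prod_i m i)%N => [|i].
  by apply: prodn_gt0 => i; apply: (s2valP (cid2 (integral_multiple (f i)))).
rewrite (bigD1 i)//= mulrnA rpredMn//.
exact: (s2valP' (cid2 (integral_multiple (f i)))).
Qed.

Definition trace_mx : 'M[rat]_n := \matrix_(i, j) trace (e`_i * e`_j).

Lemma trace_mul (x y : K) :
  trace (x * y) = (coords x *m trace_mx *m (coords y)^T) 0 0.
Proof.
have trE (i : 'I_n) : trace (e`_i * y) = \sum_j coords y 0 j * trace_mx i j.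
  rewrite {1}(coords_sum y) mulr_sumr linear_sum; apply: eq_bigr => j _.
  by rewrite -scalerAr linearZ /= [trace_mx _ _]mxE.
rewrite {1}(coords_sum x) mulr_suml linear_sum mxE.
have -> : \sum_i trace (coords x 0 i *: e`_i * y) =
    \sum_i \sum_j coords x 0 i * (coords y 0 j * trace_mx i j).
  by apply: eq_bigr => i _; rewrite -scalerAl linearZ /= trE mulr_sumr.
rewrite exchange_big; apply: eq_bigr => j _; rewrite !mxE mulr_suml.
by apply: eq_bigr => i _; rewrite mulrA mulrAC.
Qed.

Lemma trace_mx_unit : trace_mx \in unitmx.
Proof.
rewrite -row_free_unit -kermx_eq0; apply/eqP/row_matrixP => i; rewrite row0.
have /sub_kermxP := row_sub i (kermx trace_mx); move: (row i _) => v vT.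
apply: (can_inj of_coordsK); rewrite linear0; apply: trace_nondegenerate => y.
by rewrite trace_mul of_coordsK vT mul0mx mxE.
Qed.

(** The coordinates of [k] are its traces against the basis times the inverse of [trace_mx]. *)
Lemma codifferent_bounded :
  exists2 m, (0 < m)%N & forall k, k \in @codifferent K -> k *+ m \in @integers K.
Proof.
have [m1 m1_gt0 m1int] := common_integral_multiple (fun i : 'I_n => e`_i).
have [m2 m2_gt0 m2int] := common_denominator (fun ij => invmx trace_mx ij.1 ij.2).
(* One [m1] makes the traces integral, [m2] clears the inverse matrix, and the other [m1] makes the
   basis vectors integral. *)
exists (m1 * m2 * m1)%N; first by rewrite !muln_gt0 m1_gt0 m2_gt0.
move=> k /asboolP kC; pose z := coords k *m trace_mx.
have zint j : m1%:R * z 0 j \is a Num.int.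
  have := kC _ (m1int j); rewrite mulrnAr linearMn -[trace _ *+ _]mulr_natl.
  by rewrite trace_mul coords_basis trmx_delta -colE [col _ _ _ _]mxE.
have kz : coords k = z *m invmx trace_mx by rewrite mulmxK ?trace_mx_unit.
rewrite (coords_sum k) -sumrMnl rpred_sum// => j _.
have kint : (m1 * m2)%:R * coords k 0 j \is a Num.int.
  rewrite kz mxE mulr_sumr rpred_sum// => i _.
  rewrite natrM mulrACA rpredM//; exact: (m2int (i, j)).
rewrite mulrnA -[X in X *+ m1]scaler_nat scalerA -(numqK kint) scaler_int.
rewrite pmulrn mulrzAC -pmulrn; apply: (@rpredMz K (@integers K)).
exact: m1int.
Qed.

Lemma det_int (A : 'M[rat]_n) : (forall i j, A i j \is a Num.int) -> \det A \is a Num.int.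
Proof.
move=> Aint; have -> : A = map_mx intr (map_mx numq A).
  by apply/matrixP => i j; rewrite !mxE numqK.
by rewrite det_map_mx rpred_int.
Qed.

(** Its determinant is the discriminant of the family of rows of [B]. *)
Definition gram (B : 'M[rat]_n) := B *m trace_mx *m B^T.

Lemma det_gram_int (B : 'M[rat]_n) :
  (forall i, of_coords (row i B) \in @integers K) -> \det (gram B) \is a Num.int.
Proof.
move=> Bint; apply: det_int => i j.
have -> : gram B i j = trace (of_coords (row i B) * of_coords (row j B)).
  rewrite trace_mul !of_coordsK tr_row -row_mul [LHS]mxE [RHS]mxE.
  by apply: eq_bigr => k _; rewrite [row _ _ _ _]mxE [col _ _ _ _]mxE.
by apply: trace_integer; apply: rpredM; apply: Bint.
Qed.

Lemma det_replace_row (i : 'I_n) (c : 'rV[rat]_n) :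
  \det (\matrix_k if k == i then c else delta_mx 0 k) = c 0 i.
Proof.
rewrite (expand_det_row _ i).
have -> : c 0 i = (c *m \adj (1%:M)) 0 i.
  by have := mul_mx_adj (1%:M : 'M[rat]_n); rewrite mul1mx det1 => ->; rewrite mulmx1.
rewrite mxE; apply: eq_bigr => j _; rewrite !mxE eqxx; congr (_ * _).
rewrite /cofactor; congr (_ * \det _); apply/matrixP => k l.
by rewrite !mxE eq_sym (negPf (neq_lift _ _)) !mxE eqxx /= eq_sym.
Qed.

(** A basis of integral elements with minimal discriminant is an integral basis:
    if some coordinate [q] of an integral [x] is not an integer, replacing the
    corresponding basis vector by [x] minus [floor q] times it multiplies the
    discriminant by the square of the fractional part of [q]. *)
Lemma minimal_gram : exists2 B : 'M[rat]_n, B \in unitmx /\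
    (forall i, of_coords (row i B) \in @integers K) &
  forall (x : K) i, x \in @integers K -> (coords x *m invmx B) 0 i \is a Num.int.
Proof.
pose integral_rows B := forall i : 'I_n, of_coords (row i B) \in @integers K.
pose S d := `[< exists2 B, B \in unitmx /\ integral_rows B & `|\det (gram B)| = d%:R >].
have gramS B : B \in unitmx -> integral_rows B -> exists2 d, S d & `|\det (gram B)| = d%:R.
  move=> B_unit Bint; have := det_gram_int Bint; move=> /natr_norm_int/natrP[d Bd].
  by exists d => //; apply/asboolP; exists B.
have exS : exists d, S d.
  have [m m_gt0 mint] := common_integral_multiple (fun i : 'I_n => e`_i).
  have [||d Sd _] := gramS m%:R%:M; last by exists d.
    by rewrite unitmxE det_scalar unitrX// unitfE pnatr_eq0 -lt0n.
  move=> i; rewrite -scalemx1 linearZ /= row1 -coords_basis linearZ /= coordsK.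
  by rewrite scaler_nat.
case: (ex_minnP exS) => d /asboolP[B [B_unit Bint] Bd] dmin; exists B => // x i xO.
pose c := coords x *m invmx B; rewrite -/c.
apply: contraT => ci; pose f := Num.floor (c 0 i).
pose c' := c - f%:~R *: delta_mx 0 i.
have c'i : c' 0 i = c 0 i - f%:~R by rewrite !mxE !eqxx mulr1.
have c'i_gt0 : 0 < c' 0 i.
  rewrite c'i subr_gt0 lt_neqAle floor_le andbT.
  by apply: contra ci => /eqP <-; rewrite rpred_int.
have c'i_lt1 : c' 0 i < 1.
  by rewrite c'i ltrBlDl; have /andP[_] := floor_itv (c 0 i); rewrite rmorphD.
pose U := \matrix_k if k == i then c' else delta_mx 0 k.
have detU : \det U = c' 0 i := det_replace_row i c'.
have UB k : row k (U *m B) = if k == i then coords (x - of_coords (row i B) *~ f) else row k B.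
  rewrite row_mul rowK; case: eqP => _; last by rewrite -rowE.
  rewrite mulmxBl -scalemxAl -rowE mulmxKV// linearB; congr (_ - _).
  by rewrite -scaler_int linearZ /= of_coordsK.
have UB_int : integral_rows (U *m B).
  move=> k; rewrite UB; case: eqP => _ //.
  rewrite coordsK; apply: rpredB => //; apply: rpredMz; exact: Bint.
have UB_unit : U *m B \in unitmx.
  by rewrite unitmx_mul B_unit andbT unitmxE detU unitfE gt_eqF.
have [d' Sd' UBd'] := gramS _ UB_unit UB_int.
have detUGU G : \det (U *m G *m U^T) = c' 0 i * \det G * c' 0 i.
  by rewrite !det_mulmx det_tr detU.
have : (d%:R : rat) <= d'%:R by rewrite ler_nat dmin.
rewrite -UBd' -Bd.
have -> : gram (U *m B) = U *m gram B *m U^T by rewrite /gram trmx_mul !mulmxA.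
rewrite detUGU !normrM (gtr0_norm c'i_gt0) => le1.
have g0 : 0 < `|\det (gram B)|.
  by rewrite normr_gt0 -unitfE -unitmxE !unitmx_mul unitmx_tr B_unit trace_mx_unit.
have : c' 0 i * `|\det (gram B)| * c' 0 i < `|\det (gram B)|.
  rewrite mulrAC gtr_pMl//.
  by rewrite -[ltRHS]mulr1 ltr_pM// ltW.
by rewrite ltNge le1.
Qed.

Lemma integral_basis : exists (b : 'I_n -> R) (c : R -> 'I_n -> int),
  [/\ forall x, x = \sum_i b i *~ c x i,
      forall z i, c (\sum_j b j *~ z j) i = z i &
      forall x, trace (val x) = (\sum_i c (b i * x) i)%:~R].
Proof.
have [B [B_unit Bint] Bcoords] := minimal_gram.
pose b i : R := RingOfIntegers (Bint i).
pose c (x : R) i := numq ((coords (val x) *m invmx B) 0 i).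
have cE (x : R) i : (c x i)%:~R = (coords (val x) *m invmx B) 0 i.
  by rewrite numqK// Bcoords//; case: x.
have b_sum (z : 'I_n -> int) :
    \val (\sum_j b j *~ z j) = of_coords ((\row_j (z j)%:~R) *m B).
  rewrite raddf_sum mulmx_sum_row linear_sum; apply: eq_bigr => j _.
  by rewrite [LHS]raddfMz mxE linearZ /= scaler_int.
exists b, c; split=> [x|z i|x].
- apply: val_inj; rewrite b_sum -[LHS]coordsK; congr of_coords.
  rewrite -[LHS](mulmxKV B_unit); congr (_ *m _); apply/rowP => i.
  by rewrite [RHS]mxE cE.
- apply: (@intr_inj rat); rewrite cE b_sum of_coordsK mulmxK//.
  by rewrite mxE.
(* The trace is computed after conjugation by [B], that is, in the integral basis. *)
rewrite rmorph_sum /= /trace -/(regular_mx _).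
rewrite -[regular_mx _](mulKmx B_unit) mxtrace_mulC.
apply: eq_bigr => i _; rewrite cE.
have -> : val (b i * x) = val x * of_coords (row i B) by rewrite mulrC.
by rewrite coordsM of_coordsK -!row_mul [RHS]mxE.
Qed.

End Trace.

(** * The ring of integers modulo [p] *)

Lemma intr_Fp_eq0 p (i : int) : prime p -> (i%:~R == 0 :> 'F_p) = (p %| i)%Z.
Proof.
move=> p_prime; rewrite dvdzE /= (dvdn_pcharf (pchar_Fp p_prime)).
by case: i => m //; rewrite NegzE rmorphN oppr_eq0.
Qed.

Section ReductionOfIntegers.
Variables (K : fieldExtType rat) (p : nat).
Hypothesis p_prime : prime p.
Local Notation n := (\dim {:K}).
Local Notation R := (ring_of_integers K).

Lemma fieldExt_natr_neq0 m : (0 < m)%N -> m%:R != 0 :> K.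
Proof.
by move=> m_gt0; rewrite -(rmorph_nat (in_alg K)) fmorph_eq0 pnatr_eq0 -lt0n.
Qed.

Lemma integers_p_regular (x y : R) : p%:R * x = p%:R * y -> x = y.
Proof.
move/(congr1 val); rewrite !rmorphM !rmorph_nat => xy; apply: val_inj.
exact: mulfI (fieldExt_natr_neq0 (prime_gt0 p_prime)) _ _ xy.
Qed.

Lemma integersP (x : K) : x \in @integers K -> exists y : R, val y = x.
Proof. by move=> xO; exists (RingOfIntegers xO). Qed.

(** [phi] takes coordinates in an integral basis modulo [p]. The last clause is the determinant
    trick, applied to [w/p] acting on [I]. *)
Lemma reduction_of_integers : exists (phi : {additive R -> 'rV['F_p]_n})
    (phi_surj : forall v, exists x, phi x = v),
  [/\ forall x, phi x = 0 <-> (exists y, x = p%:R * y),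
      forall x, \tr (mulmat phi_surj x) = (numq (trace (val x)))%:~R &
      forall (I : R -> Prop) w, I p%:R ->
        (forall x y, I x -> I y -> I (x + y)) -> (forall a x, I x -> I (a * x)) ->
        (forall x, I x -> exists2 t, I t & w * x = p%:R * t) -> phi w = 0].
Proof.
have [b [c [c_sum c_uniq c_trace]]] := integral_basis K.
pose f (x : R) : 'rV['F_p]_n := \row_i (c x i)%:~R.
have cB x y i : c (x - y) i = c x i - c y i.
  have -> : x - y = \sum_j b j *~ (c x j - c y j).
    rewrite {1}(c_sum x) {1}(c_sum y) -sumrB.
    by apply: eq_bigr => j _; rewrite mulrzBr.
  by rewrite (c_uniq (fun j => c x j - c y j)).
have f_additive : zmod_morphism f.
  by move=> x y; apply/rowP => i; rewrite !mxE cB rmorphB.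
pose cf := GRing.isZmodMorphism.Build _ _ f f_additive.
pose phi : {additive R -> 'rV['F_p]_n} := HB.pack f cf.
have phi_surj v : exists x, phi x = v.
  exists (\sum_j b j *~ (v 0 j : nat)); apply/rowP => i; rewrite mxE c_uniq.
  by rewrite -pmulrn natr_Zp.
have phi_ker x : phi x = 0 <-> (exists y, x = p%:R * y).
  split=> [x0|[y ->]]; last first.
    rewrite mulr_natl raddfMn; apply/rowP => i.
    by rewrite mulmxnE mxE -mulr_natl (pcharf0 (pchar_Fp p_prime)) mul0r mxE.
  exists (\sum_j b j *~ (c x j %/ p)%Z); rewrite {1}(c_sum x) mulr_sumr.
  apply: eq_bigr => i _; have : (c x i)%:~R == 0 :> 'F_p.
    by have /rowP/(_ i) := x0; rewrite !mxE => ->.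
  rewrite intr_Fp_eq0// => /divzK {1}<-.
  by rewrite mulrzA -pmulrn mulr_natl.
have phi_b i : phi (b i) = delta_mx 0 i.
  apply/rowP => j; rewrite !mxE /=.
  have -> : b i = \sum_k b k *~ (k == i).
    by rewrite (bigD1 i)//= eqxx big1 ?addr0// => k /negPf ->.
  by rewrite (c_uniq (fun k => k == i : nat)) -pmulrn.
exists phi, phi_surj; split=> // [x|I w Ip ID IM Iw].
  rewrite c_trace numq_int rmorph_sum; apply: eq_bigr => i _ /=.
  have /rowP/(_ i) := row_mulmat phi_surj phi_ker x (phi_b i).
  by rewrite !mxE.
have p0 : p%:R != 0 :> K by rewrite fieldExt_natr_neq0 ?prime_gt0.
have IN x : I x -> I (- x) by move=> /(IM (-1)); rewrite mulN1r.
pose sec v := sval (cid (phi_surj v)).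
have secK v : phi (sec v) = v by apply: (svalP (cid (phi_surj v))).
(* A finite family generating [I] additively: it spans [pR] and contains a lift of each residue
   class met by [I]. Classes outside [I] contribute the default 0. *)
pose u (s : 'I_n + 'rV['F_p]_n) : R := match s with
  | inl i => p%:R * b i | inr v => if `[< I (sec v) >] then sec v else 0 end.
have Iu s : I (u s).
  have I0 : I 0 by rewrite -[0](mul0r p%:R); apply: IM.
  case: s => [i|v] /=; first by rewrite mulrC; apply: IM.
  by case: asboolP.
have span t : I t -> exists a : 'I_n + 'rV['F_p]_n -> int,
    t = \sum_s u s *~ a s.
  move=> It; have /phi_ker[r tr] : phi (t - sec (phi t)) = 0.
    by rewrite raddfB secK subrr.
  have Isec : I (sec (phi t)).
    rewrite -[sec _](subKr t) tr; apply: ID => //; apply: IN; rewrite mulrC.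
    exact: IM.
  exists (fun s => match s with inl i => c r i | inr v => (v == phi t)%:Z end).
  rewrite -[LHS](subrK (sec (phi t))) tr big_sumType /=.
  congr (_ + _).
    rewrite {1}(c_sum r) mulr_sumr; apply: eq_bigr => i _.
    by rewrite mulrzAr.
  rewrite (bigD1 (phi t))//= eqxx asboolT// big1 ?addr0// => v /negPf ->.
  by rewrite mulr0z.
pose a s s' : int := sval (cid (span _ (s2valP (cid2 (Iw _ (Iu s)))))) s'.
have wu s : w * u s = p%:R * \sum_s' u s' *~ a s s'.
  rewrite (s2valP' (cid2 (Iw _ (Iu s)))); congr (_ * _).
  exact: svalP (cid (span _ (s2valP (cid2 (Iw _ (Iu s)))))).
have /integersP[y yw] : val w / p%:R \in @integers K.
  have [i bi] : exists i, b i != 0.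
    apply: contrapT => b0; have /eqP := oner_neq0 R; case.
    rewrite (c_sum 1) big1// => i _; have [->|bi] := eqVneq (b i) 0.
      by rewrite mul0rz.
    by case: b0; exists i.
  apply/asboolP.
  apply: (@integral_of_stable _ _ (fun s => val (u s)) (inl i) a) => [|s].
    by rewrite rmorphM rmorph_nat mulf_neq0// -(rmorph0 val) (inj_eq val_inj).
  apply: (mulfI p0); rewrite mulrA mulrCA mulfV// mulr1.
  have /(congr1 val) := wu s; rewrite !rmorphM rmorph_nat => ->.
  congr (_ * _); rewrite rmorph_sum; apply: eq_bigr => s' _.
  by rewrite mulrzl raddfMz.
apply/phi_ker; exists y; apply: val_inj.
rewrite [RHS]rmorphM rmorph_nat -[RHS]/(p%:R * val y) yw.
by rewrite mulrC divfK.
Qed.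

End ReductionOfIntegers.

(** * Prime residue fields *)

Section ResidueField.
Local Open Scope quotient_scope.
Variables (R : comNzRingType) (P : prime_idealr R) (p : nat).
Hypotheses (p_prime : prime p) (pP : p%:R \in P).

Lemma natr_sub_mem_prime i j : i%:R - j%:R \in P -> i%:R = j%:R :> 'F_p.
Proof.
wlog le_ji : i j / (j <= i)%N => [W|].
  case: (leqP j i) => [/W//|/ltnW/W H ijP]; apply/esym/H.
  by rewrite -opprB rpredN.
rewrite -natrB// (natr_mem_prime p_prime _ pP) (dvdn_pcharf (pchar_Fp p_prime)) natrB//.
by rewrite subr_eq0 => /eqP.
Qed.

Lemma residue_field_iso :
  (forall x, exists j : nat, x - j%:R \in P) <->
  exists f : {rmorphism {ideal_quot P} -> 'F_p}, bijective f.
Proof.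
split=> [resP|[f f_bij] x]; last first.
  pose v := f (\pi x); exists v.
  rewrite Quotient.idealrBE; apply/eqP/(bij_inj f_bij).
  by rewrite -/v (rmorph_nat (\pi_{ideal_quot P})) rmorph_nat natr_Zp.
pose j x := sval (cid (resP x)).
have jP x : x - (j x)%:R \in P by exact: svalP (cid (resP x)).
(* A class goes to the residue of any integer representing it; [natr_sub_mem_prime] makes the choice
   irrelevant. *)
pose f (q : {ideal_quot P}) : 'F_p := (j (repr q))%:R.
have f_pi x i : x - i%:R \in P -> f (\pi x) = i%:R.
  move=> xi; apply: natr_sub_mem_prime.
  have rx : repr (\pi_{ideal_quot P} x) - x \in P.
    by rewrite Quotient.idealrBE reprK.
  set y := repr _ in rx *.
  rewrite (_ : _ - _ = (y - x) + (x - i%:R) - (y - (j y)%:R)); last by ring.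
  by apply: rpredB => //; apply: rpredD.
have f_add a b : f (a + b) = f a + f b.
  rewrite -[a]reprK -[b]reprK -raddfD (f_pi _ (j (repr a) + j (repr b))%N).
    by rewrite natrD /f !reprK.
  by rewrite natrD opprD addrACA rpredD.
have f_additive : zmod_morphism f.
  by move=> a b; apply: (@addIr _ (f b)); rewrite -f_add !subrK.
have f_multiplicative : monoid_morphism f.
  split=> [|a b].
    by rewrite -(rmorph1 (\pi_{ideal_quot P})) (f_pi _ 1%N)// subrr rpred0.
  rewrite -[a]reprK -[b]reprK -rmorphM (f_pi _ (j (repr a) * j (repr b))%N).
    by rewrite natrM /f !reprK.
  rewrite natrM; set x := repr a; set y := repr b.
  rewrite (_ : _ - _ = x * (y - (j y)%:R) + (j y)%:R * (x - (j x)%:R)); last by ring.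
  by rewrite rpredD ?idealMr.
pose f1 := GRing.isZmodMorphism.Build _ _ f f_additive.
pose f2 := GRing.isMonoidMorphism.Build _ _ f f_multiplicative.
pose F : {rmorphism {ideal_quot P} -> 'F_p} := HB.pack f f1 f2.
exists F; exists (fun v : 'F_p => \pi_{ideal_quot P} (v : nat)%:R) => [q|v]; last first.
  by rewrite /= (f_pi _ v) ?subrr ?rpred0// natr_Zp.
apply/eqP; rewrite -[X in _ == X]reprK -Quotient.idealrBE -rpredN opprB.
rewrite (_ : _ - _ = (repr q - (j (repr q))%:R) + ((j (repr q))%:R - (f q)%:R)); last by ring.
apply: rpredD; first exact: jP.
rewrite /f val_Fp_nat// (divn_eq (j (repr q)) p) natrD modnMDl modn_mod addrK natrM.
exact: idealMr.
Qed.

End ResidueField.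

(** * The different *)

Section Different.
Variables (K : fieldExtType rat) (p : nat).
Hypothesis p_prime : prime p.
Local Notation n := (\dim {:K}).
Local Notation R := (ring_of_integers K).
Variables (phi : {additive R -> 'rV['F_p]_n}) (phi_surj : forall v, exists x, phi x = v).
Hypothesis phi_ker : forall x, phi x = 0 <-> (exists y, x = p%:R * y).
Hypothesis phi_trace : forall x, \tr (mulmat phi_surj x) = (numq (trace (val x)))%:~R.

Let p0 : p%:R != 0 :> K. Proof. by rewrite fieldExt_natr_neq0 ?prime_gt0. Qed.

(** The trace of [u y / p] is an integer exactly when [p] divides the trace of [u y]. *)
Lemma trace_radical_codifferent (u : R) :
  trace_radical phi_surj u <-> val u / p%:R \in @codifferent K.
Proof.
have tr_u (y : R) : trace (val u / p%:R * val y) *+ p = trace (val (u * y)).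
  by rewrite -linearMn /= -mulrnAl -mulr_natr divfK.
have tr_int (y : R) : trace (val y) \is a Num.int.
  by apply: trace_integer; case: y.
split=> [urad|/asboolP uC y]; first apply/asboolP => _ /integersP[y <-].
  have := urad y; rewrite phi_trace => /eqP; rewrite intr_Fp_eq0// => /dvdzP[q pq].
  have -> : trace (val u / p%:R * val y) = q%:~R.
    apply: (mulfI (_ : p%:R != 0 :> rat)); first by rewrite pnatr_eq0 -lt0n prime_gt0.
    by rewrite mulr_natl tr_u -[LHS](numqK (tr_int _)) pq intrM mulrC.
  exact: rpred_int.
have /uC/intrP[i yi] : val y \in @integers K by case: (y).
rewrite phi_trace -tr_u yi.
have -> : i%:~R *+ p = (i * p)%:~R :> rat by rewrite intrM -mulr_natr.
by rewrite numq_int intrM -[p%:~R]/(p%:R) (pcharf0 (pchar_Fp p_prime)) mulr0.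
Qed.

Lemma different_annihilates (x : R) :
  x \in @different_ideal K -> annihilates_radical phi_surj x.
Proof.
move=> /asboolP xD u /trace_radical_codifferent/xD/integersP[y yxu].
apply/phi_ker; exists y; apply: val_inj.
rewrite [RHS]rmorphM rmorph_nat -[RHS]/(p%:R * val y) yxu.
by rewrite mulrCA [p%:R * (_ / _)]mulrC divfK.
Qed.

Lemma codifferent_scale (x k : K) : x \in @integers K -> k \in @codifferent K ->
  x * k \in @codifferent K.
Proof.
move=> xO /asboolP kC; apply/asboolP => y yO; rewrite mulrAC mulrC.
by apply: kC; apply: rpredM.
Qed.

(** It suffices to lower the exponent of [p] in the denominator of [l] in [c]: if
    [p ^ 2 l] is integral then it lies in [Rad], so [P l] is contained in
    [p^-1 Rad], whence [P^2 l] is integral and so is [p l]. *)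
Lemma codifferent_p_part (P : prime_idealr R) a (k : K) :
    p%:R \in ideal_exp P 2 -> (forall u, u \in P -> annihilates_radical phi_surj u) ->
    k \in @codifferent K -> k *+ p ^ a \in @integers K ->
  forall u, u \in P -> val u * k \in @integers K.
Proof.
move=> p2 PD.
have pK (z : K) : z *+ p / p%:R = z by rewrite -[z *+ p]mulr_natr mulfK.
have annP (x u : R) : val x / p%:R \in @codifferent K -> u \in P ->
    val u * (val x / p%:R) \in @integers K.
  move=> /trace_radical_codifferent xrad uP.
  have /phi_ker[y /(congr1 val) uxy] := PD u uP x xrad.
  have -> : val u * (val x / p%:R) = val y.
    apply: (mulfI p0); rewrite mulrCA -[X in _ * X]mulrC divfK//.
    by move: uxy; rewrite !rmorphM rmorph_nat.
  by case: (y).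
have step l : l \in @codifferent K -> l *+ p *+ p \in @integers K -> l *+ p \in @integers K.
  move=> lC /integersP[x xl].
  have xC : val x / p%:R \in @codifferent K.
    rewrite xl pK -mulr_natl; apply: codifferent_scale => //.
    exact: rpred_nat.
  have P2l y : y \in ideal_exp P 2 -> val y * l \in @integers K.
    elim/ideal_mul_ind => [|y1 y2 y1l y2l|u v uP]; first by rewrite mul0r rpred0.
      by rewrite mulrDl rpredD.
    rewrite -/(ideal_exp P 1) ideal_exp1 => vP.
    have /integersP[t tu] := annP x u xC uP.
    have tl : val t / p%:R = val u * l.
      by rewrite tu xl pK mulrnAr pK.
    have -> : val (u * v) * l = val v * (val t / p%:R) by rewrite tl mulrA [val v * _]mulrC.
    apply: annP => //; rewrite tl; apply: codifferent_scale => //.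
    by case: (u).
  have := P2l _ p2; rewrite rmorph_nat mulr_natl; exact.
(* For [a = 1], [k] is already of the form [x/p]; for larger exponents [step] is applied to the
   multiple of [k] by the power of [p] with exponent smaller by 2. *)
move=> kC; elim: a => [|[|a] IHa].
- move=> kO u _; rewrite expn0 mulr1n in kO; apply: rpredM => //; by case: (u).
- rewrite expn1 => /integersP[x xk] u uP.
  have -> : k = val x / p%:R by rewrite xk pK.
  by apply: annP => //; rewrite xk pK.
move=> kO; apply: IHa; rewrite expnSr mulrnA; rewrite !expnSr !mulrnA in kO.
apply: step => //; rewrite -mulr_natl; apply: codifferent_scale => //.
exact: rpred_nat.
Qed.

End Different.

(** * The primary component of the quotient by the different *)

Lemma prime_coprime_bezout p m k : prime p -> coprime p m -> (0 < m)%N ->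
  exists s t : nat, (s * m = 1 + t * p ^ k)%N.
Proof.
move=> p_prime cop m_gt0; have := coprimeXl k cop; rewrite coprime_sym.
move=> /(coprimeP _ m_gt0)[[s t] /= st]; exists s, t.
by rewrite -st subnK// ltnW// -subn_gt0 st.
Qed.

Section DifferentQuotient.
Local Open Scope quotient_scope.
Variable K : fieldExtType rat.
Local Notation R := (ring_of_integers K).
Local Notation pi := (\pi_(integers_mod_different K)).

Lemma pi_different (x : R) : pi x = 0 <-> x \in @different_ideal K.
Proof.
rewrite -[x in x \in _]subr0 Quotient.idealrBE raddf0.
by split=> [->|/eqP].
Qed.

Lemma different_idealMl (a x : R) :
  x \in @different_ideal K -> a * x \in @different_ideal K.
Proof.
move=> /asboolP xD; apply/asboolP => k kC; rewrite rmorphM -mulrA.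
by apply: rpredM; [case: (a) | apply: xD].
Qed.

Lemma natr_different m :
  (forall k, k \in @codifferent K -> k *+ m \in @integers K) ->
  (m%:R : R) \in @different_ideal K.
Proof. by move=> mC; apply/asboolP => k kC; rewrite rmorph_nat mulr_natl mC. Qed.

Variable p : nat.
Hypothesis p_prime : prime p.
Variables (phi : {additive R -> 'rV['F_p]_(\dim {:K})}).
Variable phi_surj : forall v, exists x, phi x = v.
Hypothesis phi_ker : forall x, phi x = 0 <-> (exists y, x = p%:R * y).
Hypothesis phi_trace : forall x, \tr (mulmat phi_surj x) = (numq (trace (val x)))%:~R.

(** Some [m = m' p^a] with [m'] prime to [p] lies in the different, so [m' x] falls in the primary
    component and is a multiple of the generator. Inverting [m'] modulo [p] expresses [x] modulo the
    different plus [pR], and both annihilate the radical. *)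
Lemma cyclic_generator_annihilates :
    cyclic_subgroup (primary_component (integers_mod_different K) p) ->
  exists g : R, forall x, exists i : int, annihilates_radical phi_surj (x - g *~ i).
Proof.
move=> [g _ gen]; exists (repr g) => x.
have [m m_gt0 mC] := codifferent_bounded K.
have [m' cop mE] := pfactor_coprime p_prime m_gt0.
have m'_gt0 : (0 < m')%N by move: m_gt0; rewrite mE muln_gt0 => /andP[].
have [|i xg] := gen (pi (x *+ m')).
  apply/asboolP; exists (logn p m); rewrite -raddfMn -mulrnA -mE.
  apply/pi_different; rewrite -mulr_natr; apply: different_idealMl.
  exact: natr_different.
have xgD : x *+ m' - repr g *~ i \in @different_ideal K.
  by apply/pi_different; rewrite raddfB raddfMz /= [\pi_ _ (repr g)]reprK xg subrr.
have [s [t st]] := prime_coprime_bezout 1 p_prime cop m'_gt0.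
have xs : s%:R * (x *+ m') = x + t%:R * x * p%:R.
  by rewrite !mulr_natl mulr_natr -!mulrnA mulnC st expn1 mulrnDr mulr1n.
have gs : repr g *~ (i * s) = s%:R * (repr g *~ i).
  by rewrite mulrzA -pmulrn mulr_natl.
exists (i * s); have -> : x - repr g *~ (i * s) =
    s%:R * (x *+ m' - repr g *~ i) + - t%:R * x * p%:R.
  by rewrite gs mulrBr xs !mulNr addrAC addrK.
apply: annihilates_radicalD.
  by apply: annihilates_radicalMl => //; apply: (different_annihilates p_prime phi_ker phi_trace).
apply: annihilates_radicalMl => // u _.
by apply/phi_ker; exists u.
Qed.

(** The class of [m'] generates: [m' P] lies in the different, so [m' x] and [m' j] have the same
    class when [x] is congruent to [j] modulo [P], and [m'] is invertible on elements killed by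
    [p^k]. *)
Lemma cyclic_primary_component (P : prime_idealr R) :
    p%:R \in ideal_exp P 2 -> (forall u, u \in P -> annihilates_radical phi_surj u) ->
    (forall x, exists j : nat, x - j%:R \in P) ->
  cyclic_subgroup (primary_component (integers_mod_different K) p).
Proof.
move=> p2 PD resP; have [m m_gt0 mC] := codifferent_bounded K.
have [m' cop mE] := pfactor_coprime p_prime m_gt0.
have m'_gt0 : (0 < m')%N by move: m_gt0; rewrite mE muln_gt0 => /andP[].
have PD' u : u \in P -> u *+ m' \in @different_ideal K.
  move=> uP; apply/asboolP => k kC; rewrite raddfMn mulrnAl -mulrnAr.
  apply: (codifferent_p_part (a := logn p m) p_prime phi_ker phi_trace p2 PD) => //.
    rewrite -mulr_natl; apply: codifferent_scale => //; exact: rpred_nat.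
  by rewrite -mulrnA -mE mC.
exists (pi m'%:R) => [|q].
  apply/asboolP; exists (logn p m); rewrite -raddfMn -mulrnA -mE.
  by apply/pi_different/natr_different.
rewrite -[q]reprK; set x := repr q => /asboolP[k xk].
have [s [t st]] := prime_coprime_bezout k p_prime cop m'_gt0.
have [j xj] := resP x; exists (j * s)%N.
have xm' : pi x *+ m' = pi m'%:R *+ j.
  have piMn z i : pi (z *+ i) = pi z *+ i by exact: raddfMn.
  rewrite -!piMn; apply/eqP; rewrite -subr_eq0 -raddfB; apply/eqP/pi_different.
  have -> : x *+ m' - m'%:R *+ j = (x - j%:R) *+ m'.
    by rewrite mulrnBl -!mulrnA mulnC.
  exact: PD'.
have : pi x *+ (s * m') = pi x by rewrite st mulrnDr mulr1n mulnC mulrnA xk mul0rn addr0.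
by move=> <-; rewrite mulnC mulrnA xm' -mulrnA pmulrn.
Qed.

End DifferentQuotient.

(** * Ramified primes and the equivalence *)

Section Ramification.
Variables (K : fieldExtType rat) (p : nat).
Hypothesis p_prime : prime p.
Local Notation R := (ring_of_integers K).

(** The exact order exists by [ord_exists], and it exceeds 1 once [p] is in [P^2]. *)
Lemma ramified_overP (P : prime_idealr R) :
  ramified_over P p <-> p%:R \in P /\ p%:R \in ideal_exp P 2.
Proof.
split=> [[Pp [e [pe _] e_gt1]]|[pP p2]].
  split; first by have := Pp p; rewrite dvdzz.
  by apply: (ideal_exp_le e_gt1); apply/principal_ideal_sub.
split=> [i|]; first by rewrite (intr_mem_prime p_prime _ pP) dvdzE.
have [phi [phi_surj [phi_ker _ closed]]] := reduction_of_integers K p_prime.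
have [w w0 wP] := local_annihilator phi_surj phi_ker pP.
have [e eP] := ord_exists phi_ker (@integers_p_regular K p p_prime) closed w0 wP.
by exists e => //; apply: eP.2; apply/principal_ideal_sub.
Qed.

End Ramification.

Theorem theorem5 (K : fieldExtType rat) (hK : (1 < \dim {:K})%N)
    (p : nat) (hp : prime p) (hram : ramified_in K p) :
  cyclic_subgroup (primary_component (integers_mod_different K) p)
  <->
  exists P : prime_idealr (ring_of_integers K),
    (ramified_over P p /\
     forall Q : prime_idealr (ring_of_integers K), ramified_over Q p -> Q =i P) /\
    [/\ odd p,
        is_ord P (principal_ideal (p%:R : ring_of_integers K)) 2 &
        exists f : {rmorphism {ideal_quot P} -> 'F_p}, bijective f].
Proof.
have [phi [phi_surj [phi_ker phi_trace closed]]] := reduction_of_integers K hp.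
have p_reg := @integers_p_regular K p hp.
split=> [/(cyclic_generator_annihilates hp phi_ker phi_trace)[g gD]|].
  have cyc := ramified_of_cyclic hp phi_ker p_reg closed gD.
  have [P Pram] := hram; exists P.
  have /(ramified_overP hp)[pP p2] := Pram.
  have [p_odd p3 PD resP] := cyc P pP p2.
  split; last split=> //; last exact/residue_field_iso.
    (* Every ramified prime over [p] equals the annihilator of the radical, so any two coincide. *)
    split=> // Q /(ramified_overP hp)[pQ q2] x.
    have [_ _ QD _] := cyc Q pQ q2.
    by apply/idP/idP => [/QD/PD|/PD/QD].
  split=> [|s /principal_ideal_sub ps]; first exact/principal_ideal_sub.
  by rewrite leqNgt; apply: contra p3 => /ideal_exp_le; apply.
move=> [P [[/(ramified_overP hp)[pP p2] uniqP] [p_odd [_ ordP] /residue_field_iso]]].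
move=> /(_ hp pP) resP.
have p3 : p%:R \notin ideal_exp P 3 by apply/negP => /principal_ideal_sub/ordP.
apply: (cyclic_primary_component hp phi_ker phi_trace p2 _ resP) => u uP.
apply: (ramified_annihilates_radical hp phi_ker p_reg closed p_odd pP p2 p3 resP) uP => Q pQ q2.
by apply: uniqP; apply/(ramified_overP hp).
Qed.
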